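(* Let $S$ and $\bar S$ be $(\rho,\eta)$-sprays of the mechanical $(\rho,\eta)$-systems $((E,\pi,M),F_e,(\rho,\eta)\Gamma)$ and $((E,\pi,M),\bar F_e,(\rho,\eta)\bar\Gamma)$, respectively, both relative to the same locally invertible vector bundle morphism $(g,h)$. Then $\bar S$ and $S$ are projectively related if and only if there is a 1-homogeneous function $f$ of class $C^1$ on $E$ such that, with $$A^b_a=\tfrac12(\tilde g^c_a\circ h\circ\pi)U^b\dot\partial_cf+\tfrac12 f(\tilde g^b_a\circ h\circ\pi),$$ the Berwald derivatives $(\rho,\eta)\nabla$ and $(\rho,\eta)\bar\nabla$ induced by $\mathcal H_S$ and $\mathcal H_{\bar S}$, respectively, are related by $$\begin{aligned}(\rho,\eta)\bar\nabla_XY=\;&(\rho,\eta)\nabla_XY-X^aY^b\dot\partial_bA^c_a\,\tilde\delta_c+\Big(-X^aY^bA^c_m\dot\partial_b\mathcal H^m_a-X^aY^bA^c_m\dot\partial_bA^m_a\\&-X^a\dot{\tilde Y}^b\dot\partial_bA^c_a-X^aA^m_aY^d\dot\partial_mA^c_d-X^aY^d(\rho^i_a\circ h\circ\pi)\partial_iA^c_d-X^aY^d\mathcal H^m_a\dot\partial_mA^c_d\\&+X^aY^dA^b_d\dot\partial_b\mathcal H^c_a-\dot{\tilde X}^aY^d\dot\partial_aA^c_d\Big)\dot{\tilde\partial}_c\end{aligned}$$ for all sections $X=X^a\bar{\tilde\delta}_a+\dot{\tilde X}^a\dot{\tilde\partial}_a$ and $Y=Y^b\bar{\tilde\delta}_b+\dot{\tilde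 Y}^b\dot{\tilde\partial}_b$ of $(\rho,\eta)TE$, where $\{\tilde\delta_a,\dot{\tilde\partial}_a\}$ and $\{\bar{\tilde\delta}_a,\dot{\tilde\partial}_a\}$ are the adapted bases of $\mathcal H_S$ and $\mathcal H_{\bar S}$.
   Context: Setting. $M$ is a smooth $m$-manifold, $(E,\pi,M)$ a smooth real vector bundle of rank $r$, $h,\eta:M\to M$ diffeomorphisms, and $((E,\pi,M),[\,,]_{E,h},(\rho,\eta))$ is a generalized Lie algebroid: $(\rho,\eta)$ is a vector bundle morphism from $(E,\pi,M)$ to $(TM,\tau_M,M)$ covering $\eta$, and $[\,,]_{E,h}$ is a Lie bracket on $\Gamma(E,\pi,M)$ with $[u,fv]_{E,h}=f[u,v]_{E,h}+(\Gamma(Th\circ\rho,h\circ\eta)(u)f)\,v$, where $\Gamma(Th\circ\rho,h\circ\eta)(u)$ is the vector field $Th\circ\rho\circ u\circ(h\circ\eta)^{-1}$ on $M$. The summation convention is used. In a vector bundle chart with coordinates $(x^i,y^a)$ on $E$ and local frame $(s_a)$, $[s_a,s_b]_{E,h}=L^c_{ab}s_c$, $\rho^i_a$ are the components of $\rho$ ($\rho(s_a)=\rho_a^i\,\partial/\partial x^i$), $\partial_i=\partial/\partial x^i$ and $\dot\partial_a=\partial/\partial y^a$ on $E$. Generalized tangent bundle. $(\rho,\eta)TE$ is the rank $2r$ vector subbundle of $(h\circ\pi)^*E\oplus TE$ over $E$ with local frame (natural base) $\tilde\partial_a=S_a\oplus(\rho^i_a\circ h\circ\pi)\partial_i$, $\dot{\tilde\partial}_a=0\oplus\dot\partial_a$,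 where $(S_a)$ is the frame of $(h\circ\pi)^*E$ induced by $(s_a)$. It is a Lie algebroid over $E$ with anchor $\tilde\rho(\tilde\partial_a)=(\rho^i_a\circ h\circ\pi)\partial_i$, $\tilde\rho(\dot{\tilde\partial}_a)=\dot\partial_a$, and bracket determined by the Leibniz rule and $[\tilde\partial_a,\tilde\partial_b]=(L^c_{ab}\circ h\circ\pi)\tilde\partial_c$, $[\tilde\partial_a,\dot{\tilde\partial}_b]=0$, $[\dot{\tilde\partial}_a,\dot{\tilde\partial}_b]=0$. The vertical subbundle is spanned by the $\dot{\tilde\partial}_a$. A $(\rho,\eta)$-connection $(\rho,\eta)\Gamma$ for $E$ is a left splitting of the inclusion of the vertical subbundle, with local coefficients $(\rho,\eta)\Gamma^a_c$: $X^c\tilde\partial_c+\tilde X^a\dot{\tilde\partial}_a\mapsto(\tilde X^a+(\rho,\eta)\Gamma^a_cX^c)\dot{\tilde\partial}_a$; its adapted base is $\tilde\delta_a=\tilde\partial_a-(\rho,\eta)\Gamma^b_a\dot{\tilde\partial}_b$, $\dot{\tilde\partial}_a$. $(g,h)$ is a locally invertible vector bundle morphism of $E$ covering $h$: it has local components $g^a_b$, and there are local functions $\tilde g^a_b$ on $M$ with $\tilde g^b_cg^c_a=\delta^b_a$. $\mathcal J_{(g,h)}$ is the endomorphism of $\Gamma((\rho,\eta)TE)$ with $\mathcal J_{(g,h)}(\tilde\partial_a)=(\tilde g^b_a\circ h\circ\pi)\dot{\tilde\partial}_b$, $\mathcal J_{(g,h)}(\dot{\tilde\partial}_a)=0$.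 Sprays. $U^a$ is the local function on $E$ with $U^a(u_x)=y^a$, and $\mathbb C=U^a\dot{\tilde\partial}_a$ is the Liouville section. A mechanical $(\rho,\eta)$-system is a triple $((E,\pi,M),F_e,(\rho,\eta)\Gamma)$ with $F_e=F^a\dot{\tilde\partial}_a$ a vertical section and $(\rho,\eta)\Gamma$ a $(\rho,\eta)$-connection. A $(\rho,\eta)$-semispray of it (relative to $(g,h)$) is a section $S$ with $\mathcal J_{(g,h)}(S)=\mathbb C$, written locally as $S=(g^a_b\circ h\circ\pi)U^b\tilde\partial_a-2(G^a-\frac14F^a)\dot{\tilde\partial}_a$ with local functions $G^a$; likewise $\bar S$ with $\bar G^a-\frac14\bar F^a$. A semispray $S$ is a $(\rho,\eta)$-spray if $S\circ0$ is of class $C^1$ ($0$ the null section of $E$) and $[\mathbb C,S]_{(\rho,\eta)TE}-S=0$. A function $f$ on $E$ is 1-homogeneous if $U^a\dot\partial_af=f$. Two $(\rho,\eta)$-sprays $S,\bar S$ are projectively related if there is a 1-homogeneous function $f$ of class $C^1$ on $E$ with $\bar S=S+f\mathbb C$. Horizontal projector of a spray. $\mathcal H_S(X)=\frac12\big(X+[\mathcal J_{(g,h)}X,S]_{(\rho,\eta)TE}-\mathcal J_{(g,h)}[X,S]_{(\rho,\eta)TE}\big)$. It satisfies $\mathcal H_S(\dot{\tilde\partial}_a)=0$ and $\mathcal H_S(\tilde\partial_a)=\tilde\partial_a+\mathcal H^b_a\dot{\tilde\partial}_b$, which defines the local functions $\mathcal H^b_a$; it corresponds to the $(\rho,\eta)$-connection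 with coefficients $(\rho,\eta)\Gamma^b_a=-\mathcal H^b_a$ and adapted base $\tilde\delta_a=\tilde\partial_a+\mathcal H^b_a\dot{\tilde\partial}_b$, $\dot{\tilde\partial}_a$. Similarly $\mathcal H_{\bar S}(\tilde\partial_a)=\tilde\partial_a+\bar{\mathcal H}^b_a\dot{\tilde\partial}_b=:\bar{\tilde\delta}_a$. Berwald derivative. The Berwald derivative induced by a horizontal projector whose connection has coefficients $(\rho,\eta)\Gamma^b_a$ is the linear covariant derivative $(\rho,\eta)\nabla$ on $(\rho,\eta)TE$ (with $(\rho,\eta)\nabla_Xf=\tilde\rho(X)f$ on functions and the Leibniz rule) given in the adapted base by $(\rho,\eta)\nabla_{\tilde\delta_c}\tilde\delta_b=\dot\partial_b((\rho,\eta)\Gamma^a_c)\tilde\delta_a$, $(\rho,\eta)\nabla_{\tilde\delta_c}\dot{\tilde\partial}_b=\dot\partial_b((\rho,\eta)\Gamma^a_c)\dot{\tilde\partial}_a$, $(\rho,\eta)\nabla_{\dot{\tilde\partial}_c}\tilde\delta_b=0$, $(\rho,\eta)\nabla_{\dot{\tilde\partial}_c}\dot{\tilde\partial}_b=0$. *)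

(* Defs.v *)
From HB Require Import structures.
From mathcomp Require Import all_boot all_order all_algebra.
From mathcomp Require Import all_classical all_reals all_analysis.
Set Implicit Arguments. Unset Strict Implicit. Unset Printing Implicit Defensive.
Import Order.TTheory GRing.Theory Num.Theory.
Import numFieldNormedType.Exports.
Local Open Scope classical_set_scope.
Local Open Scope ring_scope.

(* Index convention: in [T a b] standing for T^a_b the upper index comes
   first.  Coordinates on the total space of a bundle are pairs (x, y) in
   R^m * R^r. *)

(** * Smooth maps on open subsets of normed spaces *)

(* On a finite-dimensional space this is the usual C^k: the differential is
   continuous iff all the directional derivatives are. *)
Fixpoint Ck_on (R : realType) (V W : normedModType R) (k : nat)
    (U : set V) (f : V -> W) : Prop :=
  if k is k'.+1 then
    (forall x, U x -> differentiable f x) /\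
    (forall v, Ck_on k' U (fun x => 'D_v f x))
  else forall x, U x -> {for x, continuous f}.

Definition smooth_on (R : realType) (V W : normedModType R)
  (U : set V) (f : V -> W) : Prop := forall k, Ck_on k U f.

(** * Manifolds *)

Record chart (R : realType) (m : nat) (T : topologicalType) := Chart {
  cdom : set T;
  cmap : T -> 'rV[R]_m;
  cinv : 'rV[R]_m -> T }.

(* The values of [cmap] off [cdom] and of [cinv] off the image are junk. *)
Definition is_chart (R : realType) (m : nat) (T : topologicalType)
    (c : chart R m T) : Prop :=
  [/\ open (cdom c), open (cmap c @` cdom c),
      (forall x, cdom c x -> cinv c (cmap c x) = x),
      (forall x, cdom c x -> {for x, continuous (cmap c)}) &
      (forall z, (cmap c @` cdom c) z -> {for z, continuous (cinv c)})].

Definition chart_compat (R : realType) (m : nat) (T : topologicalType)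
    (c d : chart R m T) : Prop :=
  smooth_on (cmap c @` (cdom c `&` cdom d)) (cmap d \o cinv c).

(* [chart_at] is a preferred chart at each point; tangent vectors are
   represented by their coordinates in it (see [tangent]). *)
Record manifold (R : realType) (m : nat) := Manifold {
  mcar :> topologicalType;
  atlas : set (chart R m mcar);
  chart_at : mcar -> chart R m mcar;
  m_hausdorff : hausdorff_space mcar;
  m_second_countable : @second_countable mcar;
  atlas_chart : forall c, atlas c -> is_chart c;
  atlas_compat : forall c d, atlas c -> atlas d -> chart_compat c d;
  chart_at_atlas : forall p, atlas (chart_at p);
  chart_at_dom : forall p, cdom (chart_at p) p;
  atlas_maximal : forall c, is_chart c ->
    (forall d, atlas d -> chart_compat c d /\ chart_compat d c) -> atlas c }.

Definition smooth_fun_on (R : realType) (m : nat) (M : manifold R m)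
    (W : normedModType R) (V : set M) (f : M -> W) : Prop :=
  forall c, atlas c -> smooth_on (cmap c @` (cdom c `&` V)) (f \o cinv c).

Definition smooth_map (R : realType) (m : nat) (M : manifold R m)
    (h : M -> M) : Prop :=
  continuous h /\
  forall c d : chart R m M, atlas c -> atlas d ->
    smooth_on (cmap c @` (cdom c `&` h @^-1` cdom d)) (cmap d \o h \o cinv c).

Record diffeo (R : realType) (m : nat) (M : manifold R m) := Diffeo {
  dfun :> M -> M;
  dinv : M -> M;
  dfunK : cancel dfun dinv;
  dinvK : cancel dinv dfun;
  dfun_smooth : smooth_map dfun;
  dinv_smooth : smooth_map dinv }.

(* T_p M: the coordinates of a tangent vector in the chart [chart_at p]. *)
Definition tangent (R : realType) (m : nat) (M : manifold R m) (p : M) : Type :=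
  'rV[R]_m.

(* Coordinates of v in another chart c around p.  (If p is not in [cdom c]
   this is junk, except that the zero vector has zero coordinates.) *)
Definition tcoord (R : realType) (m : nat) (M : manifold R m)
    (c : chart R m M) (p : M) (v : 'rV[R]_m) : 'rV[R]_m :=
  'D_v (cmap c \o cinv (chart_at p)) (cmap (chart_at p) p).

Definition tmap (R : realType) (m : nat) (M : manifold R m) (h : M -> M)
    (p : M) (v : 'rV[R]_m) : 'rV[R]_m :=
  'D_v (cmap (chart_at (h p)) \o h \o cinv (chart_at p)) (cmap (chart_at p) p).

Definition tapp (R : realType) (m : nat) (M : manifold R m)
    (p : M) (v : 'rV[R]_m) (f : M -> R) : R :=
  'D_v (f \o cinv (chart_at p)) (cmap (chart_at p) p).

(** * Vector bundles *)

(* A local frame (s_a) over [fdom]; [fcoord] gives components in it. *)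
Record frame (R : realType) (T : Type) (F : T -> lmodType R) (r : nat) := Frame {
  fdom : set T;
  fvec : forall x : T, 'I_r -> F x;
  fcoord : forall x : T, F x -> 'rV[R]_r }.

Definition fsum (R : realType) (T : Type) (F : T -> lmodType R) (r : nat)
    (s : frame F r) (x : T) (y : 'rV[R]_r) : F x :=
  \sum_(a < r) y ord0 a *: fvec s x a.

Definition is_frame (R : realType) (T : topologicalType) (F : T -> lmodType R)
    (r : nat) (s : frame F r) : Prop :=
  open (fdom s) /\
  forall x, fdom s x ->
    (forall y, fcoord s (fsum s x y) = y) /\
    (forall e : F x, fsum s x (fcoord s e) = e).

Definition frame_compat (R : realType) (m : nat) (M : manifold R m)
    (F : M -> lmodType R) (r : nat) (s t : frame F r) : Prop :=
  forall a, smooth_fun_on (fdom s `&` fdom t) (fun x => fcoord s (fvec t x a)).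

(* A vector bundle given by its fibres together with a maximal family of
   smoothly related local frames, which determines the topology and the smooth
   structure of the total space. *)
Record vbundle (R : realType) (m : nat) (M : manifold R m) (r : nat) := VBundle {
  fib :> M -> lmodType R;
  frames : set (frame fib r);
  frame_at : M -> frame fib r;
  frames_frame : forall s, frames s -> is_frame s;
  frames_compat : forall s t, frames s -> frames t -> frame_compat s t;
  frame_at_frames : forall p, frames (frame_at p);
  frame_at_dom : forall p, fdom (frame_at p) p;
  frames_maximal : forall s, is_frame s ->
    (forall t, frames t -> frame_compat s t /\ frame_compat t s) -> frames s }.

Definition tspace (R : realType) (m r : nat) (M : manifold R m)
  (E : vbundle M r) : Type := {x : M & E x}.

Definition eproj (R : realType) (m r : nat) (M : manifold R m)
  (E : vbundle M r) (u : tspace E) : M := projT1 u.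

Definition smooth_section (R : realType) (m r : nat) (M : manifold R m)
    (E : vbundle M r) (u : forall x : M, E x) : Prop :=
  forall s, frames s -> smooth_fun_on (fdom s) (fun x => fcoord s (u x)).

(* A vector bundle chart: local coordinates (x^i) on M and a local frame (s_a);
   the coordinates (x^i, y^a) live over the points in both domains. *)
Record vbchart (R : realType) (m r : nat) (M : manifold R m)
    (E : vbundle M r) := VBChart {
  bchart : chart R m M;
  bframe : frame E r;
  bchart_atlas : atlas bchart;
  bframe_frames : frames bframe }.

Section Charts.
Context (R : realType) (m r : nat) (M : manifold R m) (E : vbundle M r).
Implicit Types (k : vbchart E) (z : 'rV[R]_m * 'rV[R]_r).

Definition vdom k : set M := cdom (bchart k) `&` fdom (bframe k).

Definition basept k z : M := cinv (bchart k) z.1.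

Definition epoint k z : tspace E :=
  existT (fun x => E x) (basept k z) (fsum (bframe k) (basept k z) z.2).

Definition ecoord k (u : tspace E) : 'rV[R]_m * 'rV[R]_r :=
  (cmap (bchart k) (eproj u), fcoord (bframe k) (projT2 u)).

Definition edom k : set ('rV[R]_m * 'rV[R]_r) :=
  [set z | (cmap (bchart k) @` vdom k) z.1].

Definition vbchart_at (p : M) : vbchart E :=
  VBChart (chart_at_atlas p) (frame_at_frames E p).

(* T_u E, represented by coordinates in the preferred chart at the base point;
   [tecoord] changes to the chart k. *)
Definition tecoord k (u : tspace E) (w : 'rV[R]_m * 'rV[R]_r) :
    'rV[R]_m * 'rV[R]_r :=
  'D_w (ecoord k \o epoint (vbchart_at (eproj u)))
       (ecoord (vbchart_at (eproj u)) u).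

(** ** Functions on E *)

Definition floc k (f : tspace E -> R) : 'rV[R]_m * 'rV[R]_r -> R :=
  f \o epoint k.

Definition C1_fun (f : tspace E -> R) : Prop :=
  forall k, Ck_on 1 (edom k) (floc k f).

End Charts.

Definition dx (R : realType) (m r : nat) (i : 'I_m)
    (F : 'rV[R]_m * 'rV[R]_r -> R) (z : 'rV[R]_m * 'rV[R]_r) : R :=
  'D_(delta_mx ord0 i, 0) F z.

Definition dy (R : realType) (m r : nat) (a : 'I_r)
    (F : 'rV[R]_m * 'rV[R]_r -> R) (z : 'rV[R]_m * 'rV[R]_r) : R :=
  'D_(0, delta_mx ord0 a) F z.

Definition homogeneous1 (R : realType) (m r : nat) (M : manifold R m)
    (E : vbundle M r) (f : tspace E -> R) : Prop :=
  forall (k : vbchart E) z, edom k z ->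
    \sum_(a < r) z.2 ord0 a * dy a (floc k f) z = floc k f z.

(** * Generalized Lie algebroids *)

(* The vector field Th o rho o u o (h o eta)^-1 on M. *)
Definition anchor_field (R : realType) (m r : nat) (M : manifold R m)
    (E : vbundle M r) (h eta : diffeo M)
    (rho : forall x : M, E x -> tangent (eta x)) (u : forall x : M, E x)
    (p : M) : 'rV[R]_m :=
  let q := dinv eta (dinv h p) in tmap h (eta q) (rho q (u q)).

Record gen_lie_algebroid (R : realType) (m r : nat) (M : manifold R m)
    (E : vbundle M r) (h eta : diffeo M) := GenLieAlgebroid {
  rho : forall x : M, E x -> 'rV[R]_m; (* rho x e : tangent (eta x) *)
  br : (forall x : M, E x) -> (forall x : M, E x) -> forall x : M, E x;
  rho_linear : forall (x : M) (a : R) (e e' : E x),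
    rho (a *: e + e') = a *: rho e + rho e';
  rho_smooth : forall (s : frame E r) (c : chart R m M) (a : 'I_r),
    frames s -> atlas c ->
    smooth_fun_on (fdom s `&` eta @^-1` cdom c)
      (fun x => tcoord c (eta x) (rho (fvec s x a)));
  br_smooth : forall u v, smooth_section u -> smooth_section v ->
    smooth_section (br u v);
  br_linear : forall (a : R) u v w, smooth_section u -> smooth_section v ->
    smooth_section w -> forall p,
    br (fun x => a *: u x + v x) w p = a *: br u w p + br v w p;
  br_anti : forall u v, smooth_section u -> smooth_section v -> forall p,
    br u v p = - br v u p;
  br_jacobi : forall u v w, smooth_section u -> smooth_section v ->
    smooth_section w -> forall p,
    br u (br v w) p + br v (br w u) p + br w (br u v) p = 0;
  br_leibniz : forall u v (f : M -> R), smooth_section u -> smooth_section v ->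
    smooth_fun_on setT (f : M -> R^o) -> forall p,
    br u (fun x => f x *: v x) p =
      f p *: br u v p + tapp p (@anchor_field R m r M E h eta rho u p) f *: v p }.

(* A locally invertible morphism (g,h) of E covering h; [gi] packages the local
   functions g~^a_b as fibrewise inverse. *)
Record loc_inv_morphism (R : realType) (m r : nat) (M : manifold R m)
    (E : vbundle M r) (h : diffeo M) := LocInvMorphism {
  g : forall x : M, E x -> E (h x);
  gi : forall x : M, E (h x) -> E x;
  g_linear : forall (x : M) (a : R) (e e' : E x),
    g (a *: e + e') = a *: g e + g e';
  gi_g : forall (x : M) (e : E x), gi (g e) = e;
  g_gi : forall (x : M) (e : E (h x)), g (gi e) = e;
  g_smooth : forall (s t : frame E r) (a : 'I_r), frames s -> frames t ->
    smooth_fun_on (fdom s `&` h @^-1` fdom t)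
      (fun x => fcoord t (g (fvec s x a)));
  gi_smooth : forall (s t : frame E r) (a : 'I_r), frames s -> frames t ->
    smooth_fun_on (fdom s `&` h @^-1` fdom t)
      (fun x => fcoord s (gi (fvec t (h x) a))) }.

(** * The generalized tangent bundle (rho,eta)TE *)

Section GTB.
Context (R : realType) (m r : nat) (M : manifold R m) (E : vbundle M r)
  (h eta : diffeo M) (A : gen_lie_algebroid E h eta) (G : loc_inv_morphism E h).
Implicit Types (k : vbchart E) (z : 'rV[R]_m * 'rV[R]_r) (x : M)
  (f : tspace E -> R).

(* Points x of a chart with h x in the domain of the frame; on these, with one
   frame (s_a) at x and at h x, all the local formulas make sense. *)
Definition hdom k : set M := vdom k `&` h @^-1` fdom (bframe k).

Definition gdom k : set ('rV[R]_m * 'rV[R]_r) :=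
  [set z | (cmap (bchart k) @` hdom k) z.1].

(* rho^i_a o h at x: components in the coordinates x^i of rho (s_a (h x)), a
   vector at eta (h x).  Antisymmetry and the Leibniz rule force eta (h x) = x
   or rho = 0 on the fibre at h x, so this does define a vector at x. *)
Definition rho_h k x (a : 'I_r) : 'rV[R]_m :=
  tcoord (bchart k) (eta (h x)) (rho A (fvec (bframe k) (h x) a)).

(* g^b_a o h (as the row of b) and g~^b_a o h. *)
Definition g_h k x (a : 'I_r) : 'rV[R]_r :=
  fcoord (bframe k) (g G (fvec (bframe k) x a)).
Definition gt_h k x (a : 'I_r) : 'rV[R]_r :=
  fcoord (bframe k) (gi G (fvec (bframe k) (h x) a)).

(* [s_a, s_b](p) for local sections: the bracket at p of any global extensions
   of the germs at p (well defined because the bracket is local). *)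
Definition frame_br (s : frame E r) (a b : 'I_r) (p : M) : E p :=
  xget 0 [set e | exists u v, [/\ smooth_section u, smooth_section v,
     \forall x \near p, u x = fvec s x a,
     \forall x \near p, v x = fvec s x b & e = br A u v p]].

(* L^c_ab o h (as the row of c). *)
Definition L_h k x (a b : 'I_r) : 'rV[R]_r :=
  fcoord (bframe k) (frame_br (bframe k) a b (h x)).

(* The fibre of (h o pi)^* E (+) TE at u. *)
Definition gfib (u : tspace E) : Type :=
  (E (h (eproj u)) * ('rV[R]_m * 'rV[R]_r))%type.

(* Components (X^a, X~^a) in the natural base. *)
Definition ncomp k (u : tspace E) (X : gfib u) : 'rV[R]_r * 'rV[R]_r :=
  (fcoord (bframe k) X.1, (tecoord k u X.2).2).

(* X lies in the span of the natural base. *)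
Definition in_gtb (u : tspace E) (X : gfib u) : Prop :=
  forall k, hdom k (eproj u) ->
    (tecoord k u X.2).1 = \sum_(a < r) (ncomp k X).1 ord0 a *: rho_h k (eproj u) a.

Definition gloc k (X : forall u, gfib u) z : 'rV[R]_r * 'rV[R]_r :=
  ncomp k (X (epoint k z)).

Definition gsection (X : forall u, gfib u) : Prop :=
  (forall u, in_gtb (X u)) /\ (forall k, smooth_on (gdom k) (gloc k X)).

(* Left splittings of the inclusion of the vertical subbundle, via their local
   coefficients Gam^a_c. *)
Definition connection (V : forall u, gfib u -> gfib u) : Prop :=
  (forall u (X : gfib u), in_gtb X -> in_gtb (V u X)) /\
  forall k, exists Gam : 'rV[R]_m * 'rV[R]_r -> 'M[R]_r,
    smooth_on (gdom k) Gam /\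
    forall z, gdom k z -> forall X : gfib (epoint k z), in_gtb X ->
      ncomp k (V _ X) =
        (0, \row_a ((ncomp k X).2 ord0 a
                    + \sum_(c < r) Gam z a c * (ncomp k X).1 ord0 c)).

(** ** Local sections

   A local section over the coordinate domain of k is given by its components
   in the natural base, as functions of the coordinates. *)

Definition lsection : Type := 'rV[R]_m * 'rV[R]_r -> 'rV[R]_r * 'rV[R]_r.
Implicit Types X Y : lsection.

Definition anchor k (w : 'rV[R]_r * 'rV[R]_r) z : 'rV[R]_m * 'rV[R]_r :=
  (\sum_(a < r) w.1 ord0 a *: rho_h k (basept k z) a, w.2).

(* The Leibniz expansion of the bracket from its values on the natural base. *)
Definition lbr k X Y : lsection := fun z =>
  'D_(anchor k (X z) z) Y z - 'D_(anchor k (Y z) z) X z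
  + (\sum_(a < r) \sum_(b < r)
       ((X z).1 ord0 a * (Y z).1 ord0 b) *: L_h k (basept k z) a b, 0).

Definition J k X : lsection := fun z =>
  (0, \sum_(a < r) (X z).1 ord0 a *: gt_h k (basept k z) a).

Definition liouville : lsection := fun z => (0, z.2).

Definition nat_base (a : 'I_r) : lsection := fun=> (delta_mx ord0 a, 0).
Definition vert_base (a : 'I_r) : lsection := fun=> (0, delta_mx ord0 a).

(** ** Sprays *)

Record mech_system := MechSystem {
  force : forall u, gfib u;
  conn : forall u, gfib u -> gfib u;
  force_section : gsection force;
  force_vertical : forall u, (force u).1 = 0;
  conn_connection : connection conn }.

Definition semispray (sys : mech_system) (S : forall u, gfib u) : Prop :=
  gsection S /\
  forall k,
    (forall z, gdom k z -> J k (gloc k S) z = liouville z) /\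
    exists Gc : 'rV[R]_m * 'rV[R]_r -> 'rV[R]_r,
      smooth_on (gdom k) Gc /\
      forall z, gdom k z ->
        gloc k S z =
          (\sum_(b < r) z.2 ord0 b *: g_h k (basept k z) b,
           - (2%:R *: (Gc z - 4%:R^-1 *: (gloc k (force sys) z).2))).

Definition spray (sys : mech_system) (S : forall u, gfib u) : Prop :=
  [/\ semispray sys S,
      (forall k, Ck_on 1 (cmap (bchart k) @` hdom k)
                   (fun v => gloc k S (v, 0))) &
      (forall k z, gdom k z ->
        lbr k liouville (gloc k S) z - gloc k S z = 0)].

Definition proj_related (S Sb : forall u, gfib u) : Prop :=
  exists f : tspace E -> R, [/\ homogeneous1 f, C1_fun f &
    forall k z, gdom k z ->
      gloc k Sb z = gloc k S z + floc k f z *: liouville z].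

(** ** The horizontal projector of a spray *)

Definition hproj k (S : forall u, gfib u) X : lsection := fun z =>
  2%:R^-1 *: (X z + lbr k (J k X) (gloc k S) z - J k (lbr k X (gloc k S)) z).

(* H^b_a, where the projector maps d~_a to d~_a + H^b_a d.~_b. *)
Definition Hcoef k (S : forall u, gfib u) (b a : 'I_r) z : R :=
  (hproj k S (nat_base a) z).2 ord0 b.

(** ** Berwald derivatives *)

(* In this part Gam b a z stands for the coefficient Gam^b_a of a connection. *)

Definition adapted_base (Gam : 'I_r -> 'I_r -> 'rV[R]_m * 'rV[R]_r -> R)
    (a : 'I_r) : lsection := fun z =>
  nat_base a z - \sum_(b < r) Gam b a z *: vert_base b z.

Definition adapted_sum (Gam : 'I_r -> 'I_r -> 'rV[R]_m * 'rV[R]_r -> R)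
    (Xh Xv : 'rV[R]_m * 'rV[R]_r -> 'rV[R]_r) : lsection := fun z =>
  \sum_(a < r) Xh z ord0 a *: adapted_base Gam a z
  + \sum_(a < r) Xv z ord0 a *: vert_base a z.

(* Component of X on d.~_a in the adapted base; the one on delta~_a is the
   component on d~_a of the natural base. *)
Definition vcomp (Gam : 'I_r -> 'I_r -> 'rV[R]_m * 'rV[R]_r -> R) X (a : 'I_r)
    z : R :=
  (X z).2 ord0 a + \sum_(c < r) Gam a c z * (X z).1 ord0 c.

(* The Leibniz expansion of nabla_X Y from the values of nabla on the adapted
   base (see the lemmas berwald_* below). *)
Definition berwald k (Gam : 'I_r -> 'I_r -> 'rV[R]_m * 'rV[R]_r -> R) X Y :
    lsection := fun z =>
  let dX := fun F : 'rV[R]_m * 'rV[R]_r -> R => 'D_(anchor k (X z) z) F z in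
  \sum_(a < r) (dX (fun z' => (Y z').1 ord0 a)
                + \sum_(c < r) \sum_(b < r)
                    (X z).1 ord0 c * (Y z).1 ord0 b * dy b (Gam a c) z)
     *: adapted_base Gam a z
  + \sum_(a < r) (dX (vcomp Gam Y a)
                + \sum_(c < r) \sum_(b < r)
                    (X z).1 ord0 c * vcomp Gam Y b z * dy b (Gam a c) z)
     *: vert_base a z.

(* The coefficients Gam^b_a = - H^b_a of the connection of the projector. *)
Definition spray_conn k (S : forall u, gfib u) (b a : 'I_r) z : R :=
  - Hcoef k S b a z.

(* A^b_a in terms of f. *)
Definition Acoef k (f : tspace E -> R) (b a : 'I_r) z : R :=
  2%:R^-1 * (\sum_(c < r) gt_h k (basept k z) a ord0 c * z.2 ord0 b
                          * dy c (floc k f) z)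
  + 2%:R^-1 * floc k f z * gt_h k (basept k z) a ord0 b.

Lemma adapted_baseE Gam a z :
  adapted_base Gam a z = (delta_mx ord0 a, \row_b - Gam b a z).
Proof.
rewrite /adapted_base /nat_base /vert_base.
have -> : \sum_(b < r) Gam b a z *: ((0, delta_mx ord0 b) : 'rV[R]_r * 'rV[R]_r)
   = (0, \row_b Gam b a z).
  rewrite [RHS](_ : _ = (0, \sum_(b < r) Gam b a z *: delta_mx ord0 b)).
    elim/big_rec2: _ => // b y1 y2 _ ->.
    by congr pair; rewrite /= scaler0 addr0.
  congr pair; rewrite [LHS]row_sum_delta; apply: eq_bigr => b _.
  by rewrite !mxE.
congr pair; rewrite /= ?subr0 // sub0r.
by apply/rowP => b; rewrite !mxE.
Qed.

Lemma vcomp_adapted Gam a b z : vcomp Gam (adapted_base Gam a) b z = 0.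
Proof.
rewrite /vcomp adapted_baseE /= mxE (bigD1 a) //= mxE !eqxx mulr1 big1 ?addr0 ?addNr //.
by move=> c ca; rewrite mxE eqxx (negbTE ca) mulr0.
Qed.

Lemma vcomp_vert Gam a b z : vcomp Gam (vert_base a) b z = (b == a)%:R.
Proof.
rewrite /vcomp /vert_base /= mxE eqxx /= big1 ?addr0 //.
by move=> c _; rewrite mxE mulr0.
Qed.

Lemma berwald_const k Gam X Y (p q : 'I_r -> R) z :
  (forall z' a, (Y z').1 ord0 a = p a) -> (forall z' a, vcomp Gam Y a z' = q a) ->
  berwald k Gam X Y z =
    \sum_(a < r) (\sum_(c < r) \sum_(b < r)
        (X z).1 ord0 c * p b * dy b (Gam a c) z) *: adapted_base Gam a z
    + \sum_(a < r) (\sum_(c < r) \sum_(b < r)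
        (X z).1 ord0 c * q b * dy b (Gam a c) z) *: vert_base a z.
Proof.
move=> Yp Yq; rewrite /berwald; congr (_ + _); apply: eq_bigr => a _; congr (_ *: _).
  have -> : (fun z' => (Y z').1 ord0 a) = fun=> p a by apply/funext.
  rewrite derive_cst add0r; apply: eq_bigr => c _; apply: eq_bigr => b _.
  by rewrite Yp.
have -> : vcomp Gam Y a = fun=> q a by apply/funext.
rewrite derive_cst add0r; apply: eq_bigr => c _; apply: eq_bigr => b _.
by rewrite Yq.
Qed.

Lemma sum_delta2 (F : 'I_r -> 'I_r -> R) (c b : 'I_r) :
  \sum_(c' < r) \sum_(b' < r) (c' == c)%:R * (b' == b)%:R * F c' b' = F c b.
Proof.
rewrite (bigD1 c) //= [X in _ + X]big1 ?addr0 => [|c' /negbTE->]; last first.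
  by rewrite big1 // => b' _; rewrite !mul0r.
rewrite (bigD1 b) //= [X in _ + X]big1 ?addr0 => [|b' /negbTE->]; last first.
  by rewrite mulr0 mul0r.
by rewrite !eqxx !mul1r.
Qed.

Lemma adapted1 Gam a z b : (adapted_base Gam a z).1 ord0 b = (b == a)%:R.
Proof. by rewrite adapted_baseE /= mxE. Qed.

Lemma berwald_hh k Gam b c z :
  berwald k Gam (adapted_base Gam c) (adapted_base Gam b) z =
  \sum_(a < r) dy b (Gam a c) z *: adapted_base Gam a z.
Proof.
rewrite (@berwald_const _ _ _ _ (fun a => (a == b)%:R) (fun=> 0)); last 2 first.
- by move=> z' a; rewrite adapted1.
- by move=> z' a; rewrite vcomp_adapted.
rewrite [X in _ + X]big1 ?addr0 => [|a _].
  apply: eq_bigr => a _; congr (_ *: _).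
  under eq_bigr do under eq_bigr do rewrite adapted1.
  by rewrite (sum_delta2 (fun c' b' => dy b' (Gam a c') z)).
rewrite big1 ?scale0r // => c' _; rewrite big1 // => b' _.
by rewrite mulr0 mul0r.
Qed.

Lemma berwald_hv k Gam b c z :
  berwald k Gam (adapted_base Gam c) (vert_base b) z =
  \sum_(a < r) dy b (Gam a c) z *: vert_base a z.
Proof.
rewrite (@berwald_const _ _ _ _ (fun=> 0) (fun a => (a == b)%:R)); last 2 first.
- by move=> z' a; rewrite mxE.
- by move=> z' a; rewrite vcomp_vert.
rewrite big1 ?add0r => [|a _].
  apply: eq_bigr => a _; congr (_ *: _).
  under eq_bigr do under eq_bigr do rewrite adapted1.
  by rewrite (sum_delta2 (fun c' b' => dy b' (Gam a c') z)).
rewrite big1 ?scale0r // => c' _; rewrite big1 // => b' _.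
by rewrite mulr0 mul0r.
Qed.

Lemma berwald_v_const k Gam c Y (p q : 'I_r -> R) z :
  (forall z' a, (Y z').1 ord0 a = p a) -> (forall z' a, vcomp Gam Y a z' = q a) ->
  berwald k Gam (vert_base c) Y z = 0.
Proof.
move=> Yp Yq; rewrite (berwald_const _ _ _ Yp Yq).
by rewrite !big1 ?addr0 // => a _; rewrite big1 ?scale0r // => c' _;
  rewrite big1 // => b' _; rewrite mxE !mul0r.
Qed.

Lemma berwald_vh k Gam b c z :
  berwald k Gam (vert_base c) (adapted_base Gam b) z = 0.
Proof.
apply: (@berwald_v_const _ _ _ _ (fun a => (a == b)%:R) (fun=> 0)) => z' a.
- by rewrite adapted1.
- by rewrite vcomp_adapted.
Qed.

Lemma berwald_vv k Gam b c z :
  berwald k Gam (vert_base c) (vert_base b) z = 0.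
Proof.
apply: (@berwald_v_const _ _ _ _ (fun=> 0) (fun a => (a == b)%:R)) => z' a.
- by rewrite mxE.
- by rewrite vcomp_vert.
Qed.

End GTB.

(* Main.v *)
(* Write [W = Sb.2 - S.2] for the vertical difference of the two sprays and
   [e_a] for the vertical vector with components [gt_a].  The first components of
   S and Sb agree, so the two projectors differ by [Hb_a - H_a = 1/2 D_{e_a} W],
   while [A_a = 1/2 D_{e_a} (f y)] by the product rule.  If [Sb = S + f C], then
   [W = f y], hence [Hb = H + A], and the relation between the Berwald derivatives
   is an algebraic consequence.

   Conversely, the horizontal part of that relation says that [Hb - H] and [A] have
   the same derivatives along the fibres.  Homogeneity is decisive here: a
   1-homogeneous function that is differentiable at the origin is linear, and W is
   2-homogeneous, so [Hb - H], f and A are linear on each fibre.  Hence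
   [Hb - H = A].  The equation [J S = C] expresses y as a combination of the [gt_a],
   so [D_y W = D_y (f y)], and Euler's identity turns this into [2 W = 2 f y]. *)

Require Import Defs.
From mathcomp Require Import all_boot all_order all_algebra.
From mathcomp Require Import all_classical all_reals all_analysis.
From mathcomp Require Import ring lra.
Import Order.TTheory GRing.Theory Num.Theory.
Import numFieldNormedType.Exports.
Local Open Scope classical_set_scope.
Local Open Scope ring_scope.

Set Implicit Arguments.
Unset Strict Implicit.

(** * Calculus in normed spaces *)

Section Calculus.
Context (R : realType).

Lemma differentiable_fst (V W : normedModType R) (z : V * W) :
  differentiable (fst : V * W -> V) z.
Proof.
apply: (@linear_differentiable R (V * W)%type V fst) => x.
exact: cvg_fst.
Qed.

Lemma differentiable_snd (V W : normedModType R) (z : V * W) :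
  differentiable (snd : V * W -> W) z.
Proof.
apply: (@linear_differentiable R (V * W)%type W snd) => x.
exact: cvg_snd.
Qed.

Lemma derive_lin (V W W' : normedModType R) (l : {linear W -> W'}) (f : V -> W)
    (x v : V) :
  continuous l -> derivable f x v -> is_derive x v (l \o f) (l ('D_v f x)).
Proof.
move=> cl df.
have cvl : (fun h => h^-1 *: (((l \o f) \o shift x) (h *: v) - (l \o f) x)) @ 0^'
    --> l ('D_v f x).
  rewrite (_ : (fun h => _) = l \o (fun h => h^-1 *: ((f \o shift x) (h *: v) - f x))).
    exact: cvg_comp df (cl _).
  by apply/funext => h /=; rewrite [RHS]linearZ /= (linearB l).
split; first by apply/cvg_ex; exists (l ('D_v f x)).
exact/cvg_lim.
Qed.

Lemma eq_growth_rate (V W : normedModType R) (f g : V -> W) (x v : V) :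
  (forall h : R, f (h *: v + x) = g (h *: v + x)) ->
  (fun h : R => h^-1 *: ((f \o shift x) (h *: v) - f x)) =
  (fun h : R => h^-1 *: ((g \o shift x) (h *: v) - g x)).
Proof.
move=> fg; have fgx : f x = g x by have := fg 0; rewrite scale0r add0r.
by apply/funext => h /=; rewrite fg fgx.
Qed.

(** Derivability along [v] only sees values on the line through [x]. This serves for [Hcoef], which
    is compared with a differentiable function on a single fibre. *)
Lemma derivable_line (V W : normedModType R) (f g : V -> W) (x v : V) :
  (forall h : R, f (h *: v + x) = g (h *: v + x)) ->
  derivable f x v -> derivable g x v.
Proof. by move=> /eq_growth_rate e; rewrite /derivable e. Qed.

(** The differential of [f] also serves for [g]: the two remainders agree near 0, and the little-o
    condition is local. *)
Lemma near_eq_differentiable (V W : normedModType R) (f g : V -> W) (x : V) :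
  (\forall y \near x, f y = g y) -> differentiable f x -> differentiable g x.
Proof.
move=> fg df; have cdf : continuous ('d f x) by exact: diff_continuous.
have e : g \o shift x = cst (g x) + 'd f x +o_ 0 id.
  apply/eqaddoP => _/posnumP[eps].
  have /eqaddoP/(_ eps%:num) := diff_locally df.
  move=> /(_ [gt0 of eps%:num]); apply: filter_app.
  have : \forall y \near 0, f (y + x) = g (y + x).
    by have := fg; rewrite (near_shift 0) /= subr0.
  apply: filter_app; near=> y => fgy.
  have gfE : (g \o shift x - (cst (g x) + 'd f x)) y =
      (f \o shift x - (cst (f x) + 'd f x)) y.
    have -> : (g \o shift x - (cst (g x) + 'd f x)) y = g (y + x) - (g x + 'd f x y) by [].
    by rewrite -fgy -(nbhs_singleton fg).
  by rewrite gfE.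
by apply/diff_locallyP; rewrite (diff_unique cdf e); split.
Unshelve. all: by end_near. Qed.

(** A multiple of [(0, v)] does not move the base component, so both sides are limits of the same
    difference quotient. *)
Lemma derive_fibre (V1 V2 W : normedModType R) (F : V1 * V2 -> W) (x : V1) (y v : V2) :
  'D_v (fun y' => F (x, y')) y = 'D_(0, v) F (x, y).
Proof.
rewrite /derive; set g1 := fun h => h^-1 *: _; set g2 := fun h => h^-1 *: _.
suff -> : g1 = g2 by [].
apply/funext => h; rewrite /g1 /g2 /=; congr (_ *: (F _ - _)).
by congr pair; rewrite /= scaler0 add0r.
Qed.

Lemma differentiable_fibre (V1 V2 W : normedModType R) (F : V1 * V2 -> W) (x : V1) (y : V2) :
  differentiable F (x, y) -> differentiable (fun y' => F (x, y')) y.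
Proof.
move=> dF; apply: (@differentiable_comp _ _ _ _ (fun y' => (x, y')) F) => //.
Qed.

Lemma is_derive_comp_curve (V W : normedModType R) (F : V -> W) (c : R -> V)
    (t : R) (u : V) :
  differentiable F (c t) -> is_derive t (1 : R) c u ->
  is_derive t (1 : R) (F \o c) ('D_u F (c t)).
Proof.
move=> dF [/derivable1_diffP dc cE].
apply: DeriveDef; first by apply: diff_derivable; apply: differentiable_comp.
rewrite deriveE; last exact: differentiable_comp.
by rewrite diff_comp //= deriveE // -cE deriveE.
Qed.

Lemma is_derive_scalel (V : normedModType R) (c : R -> R) (t d : R) (y : V) :
  is_derive t (1 : R) c d -> is_derive t (1 : R) (fun s => c s *: y) (d *: y).
Proof.
move=> dc; have dy : differentiable ( *:%R ^~ y : R -> V) (c t) by [].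
have -> : d *: y = 'D_d ( *:%R ^~ y : R -> V) (c t) by rewrite deriveE // diff_val.
exact: is_derive_comp_curve dy dc.
Qed.

(** By Euler's identity [s |-> F (expR s *: y) * expR (- (n%:R * s))] has zero derivative; comparing
    [s = ln t] with [s = 0] gives the claim. *)
Lemma euler_homogeneous (V : normedModType R) (n : nat) (F : V -> R) :
  (forall y, differentiable F y) -> (forall y, 'D_y F y = n%:R * F y) ->
  forall (t : R) y, 0 < t -> F (t *: y) = t ^+ n * F y.
Proof.
move=> dF eF t y t0.
pose p s : R := F (expR s *: y) * expR (- (n%:R * s)).
have dp (s : R) : is_derive s (1 : R) p 0.
  have dFc : is_derive s (1 : R) (F \o (fun s => expR s *: y))
      ('D_(expR s *: y) F (expR s *: y)).
    by apply: is_derive_comp_curve => //; exact: is_derive_scalel.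
  have de : is_derive s (1 : R) (expR \o (fun s => - (n%:R * s)))
      ('D_(- n%:R) expR (- (n%:R * s))).
    apply: is_derive_comp_curve; first exact/derivable1_diffP.
    by apply: is_derive_eq; rewrite [_%:A]mulr1.
  have -> : p = (F \o (fun s => expR s *: y)) * (expR \o (fun s => - (n%:R * s))).
    by [].
  apply: is_derive_eq.
  rewrite eF deriveE; last exact/derivable1_diffP.
  rewrite -[X in 'd _ _ X]mulr1 linearZ /= -deriveE; last exact/derivable1_diffP.
  rewrite derive_val /= /GRing.scale /=; ring.
have := is_derive_0_is_cst (ln t) 0 dp.
rewrite /p lnK ?posrE// expR0 scale1r mulr0 oppr0 expR0 mulr1 => <-.
rewrite expRN expRM_natl lnK ?posrE// mulrCA divff ?mulr1//.
by rewrite expf_neq0 // gt_eqF.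
Qed.

(** For [h > 0] the quotient of [F (h *: y)] by [h] is constantly [F y], so the derivative at the
    origin along [y] is [F y] itself. *)
Lemma homogeneous1_linear (V : normedModType R) (F : V -> R) :
  differentiable F 0 -> (forall (t : R) y, 0 < t -> F (t *: y) = t * F y) ->
  forall y, F y = 'd F 0 y.
Proof.
move=> dF hF y.
have F0 : F 0 = 0.
  by have := hF 2 0 ltac:(lra); rewrite scaler0; lra.
rewrite -deriveE //.
have dy := @diff_derivable _ _ _ F 0 y dF.
(* Homogeneity is available for positive factors only, so the two-sided limit is evaluated from the
   right. *)
rewrite /derive (cvg_at_rightE _ _ dy); apply/esym/cvg_lim => //.
apply: cvg_near_cst; near=> h.
have h0 : 0 < h by [].
by rewrite /= addr0 F0 subr0 hF // /GRing.scale /= mulrA mulVf ?mul1r// gt_eqF.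
Unshelve. all: by end_near. Qed.

(** Differentiating F(ty) = t^2 F(y) in y along v gives t D_vF(ty) = t^2 D_vF(y), and one factor t
    cancels. *)
Lemma homogeneous2_derive (V : normedModType R) (F : V -> R) (v : V) :
  (forall y, differentiable F y) ->
  (forall (t : R) y, 0 < t -> F (t *: y) = t ^+ 2 * F y) ->
  forall (t : R) y, 0 < t -> 'D_v F (t *: y) = t * 'D_v F y.
Proof.
move=> dF hF t y t0.
have dt : differentiable ( *:%R t : V -> V) y by [].
have dFt := @diff_comp _ _ _ _ ( *:%R t : V -> V) F y dt (dF _).
have FtE : F \o ( *:%R t : V -> V) = t ^+ 2 \*: F by apply/funext => x /=; rewrite hF.
have := congr1 (fun D => D v) dFt.
rewrite FtE -deriveE; last exact: differentiableZ.
rewrite deriveZ /=; last exact: diff_derivable.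
rewrite [in X in _ = X -> _]diff_val linearZ /= -deriveE // /GRing.scale /=.
rewrite expr2 -mulrA => /mulfI -> //.
by rewrite gt_eqF.
Qed.

Lemma derive_snd (V W1 W2 : normedModType R) (F : V -> W1 * W2) (x v : V) :
  differentiable F x -> 'D_v (fun y => (F y).2) x = ('D_v F x).2.
Proof.
move=> dF.
have cs : continuous (snd : W1 * W2 -> W2) by move=> w; exact: cvg_snd.
by have [] := derive_lin (l := snd) cs (diff_derivable (v := v) dF).
Qed.

Lemma derive_fst (V W1 W2 : normedModType R) (F : V -> W1 * W2) (x v : V) :
  differentiable F x -> 'D_v (fun y => (F y).1) x = ('D_v F x).1.
Proof.
move=> dF.
have cs : continuous (fst : W1 * W2 -> W1) by move=> w; exact: cvg_fst.
by have [] := derive_lin (l := fst) cs (diff_derivable (v := v) dF).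
Qed.

Lemma differentiable_row_coord (V : normedModType R) n (F : V -> 'rV[R]_n) (b : 'I_n) x :
  differentiable F x -> differentiable (fun y => F y ord0 b) x.
Proof. by move=> dF; exact: (differentiable_comp dF (differentiable_coord _ _ _)). Qed.

Lemma derive_row_coord (V : normedModType R) n (F : V -> 'rV[R]_n) (b : 'I_n) x v :
  differentiable F x -> 'D_v (fun y => F y ord0 b) x = 'D_v F x ord0 b.
Proof. by move=> dF; rewrite (derive_mx (diff_derivable (v := v) dF)) mxE. Qed.

Lemma differentiable_pair2 (V W1 W2 : normedModType R) (F : V -> W1 * W2) x :
  differentiable F x -> differentiable (fun y => (F y).2) x.
Proof. by move=> dF; exact: (differentiable_comp dF (differentiable_snd _)). Qed.

Lemma differentiable_pair1 (V W1 W2 : normedModType R) (F : V -> W1 * W2) x :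
  differentiable F x -> differentiable (fun y => (F y).1) x.
Proof. by move=> dF; exact: (differentiable_comp dF (differentiable_fst _)). Qed.

End Calculus.

(** * Differentiability of smooth maps and of their derivatives *)

Section Smoothness.
Context (R : realType) (V W : normedModType R).

Lemma smooth_on_differentiable (U : set V) (f : V -> W) x :
  smooth_on U f -> U x -> differentiable f x.
Proof. by move=> /(_ 1%N) [df _]; exact: df. Qed.

Lemma smooth_on_derive_differentiable (U : set V) (f : V -> W) x v :
  smooth_on U f -> U x -> differentiable (fun y => 'D_v f y) x.
Proof. by move=> /(_ 2%N) [_ /(_ v)[df _]]; exact: df. Qed.

Lemma smooth_on_cst (U : set V) (w : W) : smooth_on U (cst w).
Proof.
move=> n; elim: n w => [|n IHn] w /=; first by move=> x _; exact: cst_continuous.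
split=> [x _|v]; first exact: differentiable_cst.
rewrite (_ : (fun x => _) = cst 0) //.
by apply/funext => x; rewrite derive_cst.
Qed.

End Smoothness.

(** * Directional derivatives in coordinates and finite sums *)

Section Coordinates.
Context (R : realType).

Lemma row_pairE (m r : nat) (w : 'rV[R]_m * 'rV[R]_r) :
  w = \sum_(i < m) w.1 ord0 i *: (delta_mx ord0 i, 0)
    + \sum_(a < r) w.2 ord0 a *: (0, delta_mx ord0 a).
Proof.
have pair_sum1 n (F : 'I_n -> R) (e : 'I_n -> 'rV[R]_m) :
    \sum_(i < n) F i *: ((e i, 0) : 'rV[R]_m * 'rV[R]_r) = (\sum_(i < n) F i *: e i, 0).
  elim/big_rec2: _ => // i y1 y2 _ ->.
  by congr pair; rewrite /= scaler0 addr0.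
have pair_sum2 n (F : 'I_n -> R) (e : 'I_n -> 'rV[R]_r) :
    \sum_(i < n) F i *: ((0, e i) : 'rV[R]_m * 'rV[R]_r) = (0, \sum_(i < n) F i *: e i).
  elim/big_rec2: _ => // i y1 y2 _ ->.
  by congr pair; rewrite /= scaler0 addr0.
rewrite pair_sum1 pair_sum2 -!row_sum_delta.
by case: w => w1 w2; congr pair; rewrite /= ?addr0 ?add0r.
Qed.

Lemma derive_coords (m r : nat) (F : 'rV[R]_m * 'rV[R]_r -> R)
    (z w : 'rV[R]_m * 'rV[R]_r) :
  differentiable F z ->
  'D_w F z = \sum_(i < m) w.1 ord0 i * dx i F z + \sum_(a < r) w.2 ord0 a * dy a F z.
Proof.
move=> dF; rewrite deriveE // [in LHS](@row_pairE m r w) linearD !linear_sum /=.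
by congr (_ + _); apply: eq_bigr => i _; rewrite linearZ /dx /dy deriveE.
Qed.

Lemma derive_bigsum (V : normedModType R) (n : nat) (f : 'I_n -> V -> R) (x v : V) :
  (forall i, derivable (f i) x v) ->
  is_derive x v (fun y => \sum_(i < n) f i y) (\sum_(i < n) 'D_v (f i) x).
Proof.
move=> df; have -> : (fun y => \sum_(i < n) f i y) = \sum_(i < n) f i.
  by apply/funext => y; rewrite fct_sumE.
by apply: is_derive_sum => i; exact: derivableP.
Qed.

Lemma differentiable_bigsum (V W : normedModType R) (n : nat) (f : 'I_n -> V -> W) (x : V) :
  (forall i, differentiable (f i) x) ->
  differentiable (fun y => \sum_(i < n) f i y) x.
Proof.
move=> df; have -> : (fun y => \sum_(i < n) f i y) = \sum_(i < n) f i.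
  by apply/funext => y; rewrite fct_sumE.
exact: differentiable_sum.
Qed.

End Coordinates.

(** * Rigidity of homogeneous functions on a fibre *)

Section Rigidity.
Context (R : realType) (r : nat).

Lemma linear_ext_basis (f g : {linear 'rV[R]_r -> R}) :
  (forall c, f (delta_mx ord0 c) = g (delta_mx ord0 c)) -> forall y, f y = g y.
Proof.
move=> fg y; rewrite (row_sum_delta y) !linear_sum /=.
by apply: eq_bigr => c _; rewrite !linearZ fg.
Qed.

(** On a fibre, [w] stands for a component of the difference of the sprays, [phi] for f and [g] for
    a vector [gt_h]. Both ['D_g w] and ['D_g p] are 1-homogeneous and differentiable at the origin,
    hence linear, and a linear form is determined by its derivatives along the basis. *)
Lemma homogeneous2_rigidity (w phi : 'rV[R]_r -> R) (b : 'I_r) (g : 'rV[R]_r) :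
  let p y := phi y * y ord0 b in
  (forall y, differentiable w y) -> (forall y, 'D_y w y = 2%:R * w y) ->
  differentiable (fun y => 'D_g w y) 0 ->
  (forall y, differentiable phi y) -> (forall y, 'D_y phi y = phi y) ->
  (forall c, 'D_(delta_mx ord0 c) (fun y => 2%:R^-1 * 'D_g w y) 0 =
             'D_(delta_mx ord0 c) (fun y => 2%:R^-1 * 'D_g p y) 0) ->
  forall y, 'D_g w y = 'D_g p y.
Proof.
move=> p dw ew dDw dphi ephi wp y.
have hphi (t : R) x : 0 < t -> phi (t *: x) = t * phi x.
  by move=> t0; rewrite (euler_homogeneous (n := 1)) // => u; rewrite mul1r.
(* Differentiability at the origin makes [phi] linear, so its derivative along [g] is the constant
   [phi g]. *)
have phiE := homogeneous1_linear (dphi 0) hphi.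
have dpE x : 'D_g p x = phi g * x ord0 b + phi x * g ord0 b.
  have dx : differentiable (fun x : 'rV[R]_r => x ord0 b) x.
    exact: differentiable_coord.
  rewrite (deriveM (diff_derivable (v := g) (dphi x)) (diff_derivable (v := g) dx)).
  have -> : 'D_g (fun x : 'rV[R]_r => x ord0 b) x = g ord0 b.
    by rewrite (derive_row_coord (F := id)) // derive_id.
  have -> : 'D_g phi x = phi g.
    have cphi : continuous ('d phi 0) by exact: diff_continuous.
    have phiE' : phi = 'd phi 0 :> (_ -> R) by apply/funext.
    apply: etrans (congr1 (fun q : 'rV[R]_r -> R => 'D_g q x) phiE') _.
    apply: etrans (deriveE g (linear_differentiable x cphi)) _.
    by rewrite diff_lin // -phiE.
  by rewrite addrC /GRing.scale /= mulrC.
have dp0 : differentiable (fun x => 'D_g p x) 0.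
  rewrite (_ : (fun x => _) =
    (fun x : 'rV[R]_r => phi g * x ord0 b + phi x * g ord0 b)); last first.
    by apply/funext => x; rewrite dpE.
  have dcst (c : R) : differentiable (cst c : 'rV[R]_r -> R) 0 by exact: differentiable_cst.
  exact: (differentiableD (differentiableM (dcst (phi g)) (differentiable_coord _ _ _))
    (differentiableM (dphi 0) (dcst (g ord0 b)))).
have hp (t : R) x : 0 < t -> 'D_g p (t *: x) = t * 'D_g p x.
  by move=> t0; rewrite !dpE hphi // mxE; ring.
have hw := homogeneous2_derive g dw (euler_homogeneous dw ew).
rewrite (homogeneous1_linear dDw hw) (homogeneous1_linear dp0 hp).
apply: linear_ext_basis => c.
apply: etrans (esym (deriveE _ dDw)) _; apply: etrans _ (deriveE _ dp0).
have half (q : 'rV[R]_r -> R) : differentiable q 0 ->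
    'D_(delta_mx ord0 c) (fun y => 2%:R^-1 * q y) 0 =
    2%:R^-1 * 'D_(delta_mx ord0 c) q 0.
  by move=> dq; exact: (deriveZ _ (diff_derivable (v := delta_mx ord0 c) dq)).
have half0 : 2%:R^-1 != 0 :> R by rewrite invr_eq0 pnatr_eq0.
exact: (mulfI half0 (etrans (esym (half _ dDw)) (etrans (wp c) (half _ dp0)))).
Qed.

End Rigidity.

(** * Berwald derivatives of two connections *)

Section BerwaldShift.
Context (R : realType) (m r : nat) (M : manifold R m) (E : vbundle M r)
  (h eta : diffeo M) (L : gen_lie_algebroid E h eta) (k : vbchart E).
Implicit Types (Gam H A : 'I_r -> 'I_r -> 'rV[R]_m * 'rV[R]_r -> R)
  (z : 'rV[R]_m * 'rV[R]_r).

Lemma sum_adapted_baseE Gam (P : 'I_r -> R) z :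
  \sum_(a < r) P a *: adapted_base Gam a z =
  (\row_a P a, - \row_b \sum_(a < r) P a * Gam b a z).
Proof.
rewrite [LHS](_ : _ = (\sum_(a < r) P a *: delta_mx ord0 a,
                       \sum_(a < r) P a *: \row_b - Gam b a z)).
  congr pair.
    by rewrite [RHS]row_sum_delta; apply: eq_bigr => a _; rewrite mxE.
  apply/rowP => b; rewrite summxE !mxE -sumrN.
  by apply: eq_bigr => a _; rewrite !mxE mulrN.
by elim/big_rec3: _ => // a y1 y2 y3 _ ->; rewrite adapted_baseE.
Qed.

Lemma sum_vert_baseE (Q : 'I_r -> R) z :
  \sum_(a < r) Q a *: (vert_base a z : 'rV[R]_r * 'rV[R]_r) = (0, \row_a Q a).
Proof.
rewrite [LHS](_ : _ = (0, \sum_(a < r) Q a *: delta_mx ord0 a)).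
  by congr pair; rewrite [RHS]row_sum_delta; apply: eq_bigr => a _; rewrite mxE.
elim/big_rec2: _ => // a y1 y2 _ ->.
by congr pair; rewrite /= scaler0 addr0.
Qed.

Lemma base_sumE Gam (P Q : 'I_r -> R) z :
  \sum_(a < r) P a *: adapted_base Gam a z
    + \sum_(a < r) Q a *: (vert_base a z : 'rV[R]_r * 'rV[R]_r) =
  (\row_a P a, \row_b (Q b - \sum_(a < r) P a * Gam b a z)).
Proof.
rewrite sum_adapted_baseE sum_vert_baseE; congr pair; rewrite /= ?addr0 //.
by apply/rowP => b; rewrite !mxE addrC.
Qed.

Lemma adapted_sumE Gam (Xh Xv : 'rV[R]_m * 'rV[R]_r -> 'rV[R]_r) z :
  adapted_sum Gam Xh Xv z =
  (Xh z, \row_b (Xv z ord0 b - \sum_(a < r) Xh z ord0 a * Gam b a z)).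
Proof.
rewrite /adapted_sum base_sumE; congr pair.
by apply/rowP => a; rewrite mxE.
Qed.

(** Change of adapted base: [Y] is given in the base of [Gamb], but its derivative for [Gam] needs
    its components in the base of [Gam]. *)
Lemma vcomp_adapted_sum Gam Gamb (Yh Yv : 'rV[R]_m * 'rV[R]_r -> 'rV[R]_r) a z :
  vcomp Gam (adapted_sum Gamb Yh Yv) a z =
  Yv z ord0 a + \sum_(c < r) (Gam a c z - Gamb a c z) * Yh z ord0 c.
Proof.
rewrite /vcomp adapted_sumE /= mxE -addrA; congr (_ + _).
rewrite addrC -sumrB; apply: eq_bigr => c _; ring.
Qed.

(* The d.~_c component of the theorem, with [dA n c d] for the derivative of A^c_d
   along y^n, [dXA] for its derivative along X, [dYh] and [dYv] for those of
   the components of Y. *)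
Lemma berwald_shift_vertical (Xh Xv Yh Yv dYh dYv : 'I_r -> R)
    (H A : 'I_r -> 'I_r -> R) (dH dA : 'I_r -> 'I_r -> 'I_r -> R)
    (rh : 'I_r -> 'I_m -> R) (dxA : 'I_m -> 'I_r -> 'I_r -> R)
    (dXA : 'I_r -> 'I_r -> R) (c : 'I_r) :
  (forall d, dXA c d =
     \sum_(i < m) (\sum_(a < r) Xh a * rh a i) * dxA i c d
     + \sum_(n < r) (Xv n + \sum_(a < r) Xh a * (H n a + A n a)) * dA n c d) ->
  dYv c + \sum_(a < r) \sum_(b < r) Xh a * Yv b * (- dH b c a - dA b c a)
  + \sum_(n < r) (dYh n + \sum_(a < r) \sum_(b < r)
                    Xh a * Yh b * (- dH b n a - dA b n a)) * A c n =
  dYv c + \sum_(d < r) (A c d * dYh d + Yh d * dXA c d)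
  + \sum_(a < r) \sum_(b < r)
      Xh a * (Yv b + \sum_(d < r) A b d * Yh d) * (- dH b c a)
  + (- (\sum_(a < r) \sum_(b < r) \sum_(n < r) Xh a * Yh b * A c n * dH b n a)
     - (\sum_(a < r) \sum_(b < r) \sum_(n < r) Xh a * Yh b * A c n * dA b n a)
     - (\sum_(a < r) \sum_(b < r) Xh a * Yv b * dA b c a)
     - (\sum_(a < r) \sum_(n < r) \sum_(d < r) Xh a * A n a * Yh d * dA n c d)
     - (\sum_(a < r) \sum_(d < r) \sum_(i < m) Xh a * Yh d * rh a i * dxA i c d)
     - (\sum_(a < r) \sum_(d < r) \sum_(n < r) Xh a * Yh d * H n a * dA n c d)
     + (\sum_(a < r) \sum_(d < r) \sum_(b < r) Xh a * Yh d * A b d * dH b c a)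
     - (\sum_(a < r) \sum_(d < r) Xv a * Yh d * dA a c d)).
Proof.
move=> dXAE.
(* The factor [A c n] comes from passing between the two adapted bases; the expansion yields the
   first two correction terms. *)
have -> : \sum_(n < r) (dYh n + \sum_(a < r) \sum_(b < r)
      Xh a * Yh b * (- dH b n a - dA b n a)) * A c n =
    \sum_(d < r) A c d * dYh d
    - (\sum_(a < r) \sum_(b < r) \sum_(n < r) Xh a * Yh b * A c n * dH b n a)
    - (\sum_(a < r) \sum_(b < r) \sum_(n < r) Xh a * Yh b * A c n * dA b n a).
  under eq_bigr => n _.
    rewrite mulrDl [dYh n * _]mulrC mulr_suml.
    under [X in _ + X]eq_bigr do rewrite mulr_suml.
    over.
  rewrite big_split /= -!addrA; congr (_ + _); rewrite -opprD -big_split /= -sumrN.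
  rewrite exchange_big /=; apply: eq_bigr => a _.
  rewrite -big_split /= -sumrN exchange_big /=; apply: eq_bigr => b _.
  rewrite -big_split /= -sumrN; apply: eq_bigr => n _; ring.
have -> : \sum_(a < r) \sum_(b < r) Xh a * Yv b * (- dH b c a - dA b c a) =
    \sum_(a < r) \sum_(b < r) Xh a * Yv b * (- dH b c a)
    - \sum_(a < r) \sum_(b < r) Xh a * Yv b * dA b c a.
  rewrite -sumrB; apply: eq_bigr => a _; rewrite -sumrB; apply: eq_bigr => b _; ring.
(* [Yv b] plus the sum is the vertical component of [Y] in the unbarred base; its [A] part cancels
   the seventh correction term. *)
have -> : \sum_(a < r) \sum_(b < r)
      Xh a * (Yv b + \sum_(d < r) A b d * Yh d) * (- dH b c a) =
    \sum_(a < r) \sum_(b < r) Xh a * Yv b * (- dH b c a)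
    - \sum_(a < r) \sum_(d < r) \sum_(b < r) Xh a * Yh d * A b d * dH b c a.
  rewrite -sumrB; apply: eq_bigr => a _; rewrite exchange_big /= -sumrB.
  apply: eq_bigr => b _; rewrite mulrDr mulrDl mulr_sumr mulr_suml -sumrN.
  congr (_ + _); apply: eq_bigr => d _; ring.
(* This is the product rule for A^c_d Y^d along X. The four sums obtained from [dXA] cancel
   correction terms four, five, six and eight. *)
have -> : \sum_(d < r) (A c d * dYh d + Yh d * dXA c d) =
    \sum_(d < r) A c d * dYh d
    + (\sum_(a < r) \sum_(n < r) \sum_(d < r) Xh a * A n a * Yh d * dA n c d)
    + (\sum_(a < r) \sum_(d < r) \sum_(i < m) Xh a * Yh d * rh a i * dxA i c d)
    + (\sum_(a < r) \sum_(d < r) \sum_(n < r) Xh a * Yh d * H n a * dA n c d)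
    + (\sum_(a < r) \sum_(d < r) Xv a * Yh d * dA a c d).
  rewrite big_split /= -!addrA; congr (_ + _).
  under [X in X + _]eq_bigr do rewrite exchange_big.
  rewrite [X in X + _]exchange_big [X in _ + (X + _)]exchange_big.
  rewrite [X in _ + (_ + (X + _))]exchange_big [X in _ + (_ + (_ + X))]exchange_big /=.
  rewrite -!big_split /=; apply: eq_bigr => d _; rewrite dXAE mulrDr.
  rewrite addrCA; congr (_ + _).
    rewrite mulr_sumr exchange_big; apply: eq_bigr => i _ /=.
    rewrite mulr_suml mulr_sumr; apply: eq_bigr => a _; ring.
  rewrite [X in _ = _ + (X + _)]exchange_big [X in _ = X + _]exchange_big -!big_split mulr_sumr /=.
  apply: eq_bigr => n _ /=; rewrite addrA -big_split /= [in LHS]mulrDl mulrDr [LHS]addrC.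
  rewrite mulr_suml mulr_sumr; congr (_ + _); last by ring.
  apply: eq_bigr => a _; ring.
ring.
Qed.

(** The coefficients themselves are differentiated along the fibre, whence the directional
    hypothesis on [H]. [A] is also differentiated along [X], because it enters the vertical
    components of [Y] in the base of [Gam]. *)
Lemma berwald_shift H A Gamb (Xh Xv Yh Yv : 'rV[R]_m * 'rV[R]_r -> 'rV[R]_r) z
    (Gam := fun b a z' => - H b a z') :
  (forall b a, \forall z' \near z, Gamb b a z' = Gam b a z' - A b a z') ->
  (forall b a c, derivable (H b a) z (0, delta_mx ord0 c)) ->
  (forall b a, differentiable (A b a) z) ->
  differentiable Yh z -> differentiable Yv z ->
  let X := adapted_sum Gamb Xh Xv in
  let Y := adapted_sum Gamb Yh Yv in
  berwald L k Gamb X Y z =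
    berwald L k Gam X Y z
    - \sum_(c < r) (\sum_(a < r) \sum_(b < r)
         Xh z ord0 a * Yh z ord0 b * dy b (A c a) z)
        *: adapted_base Gam c z
    + \sum_(c < r)
        (- (\sum_(a < r) \sum_(b < r) \sum_(n < r)
              Xh z ord0 a * Yh z ord0 b * A c n z * dy b (H n a) z)
         - (\sum_(a < r) \sum_(b < r) \sum_(n < r)
              Xh z ord0 a * Yh z ord0 b * A c n z * dy b (A n a) z)
         - (\sum_(a < r) \sum_(b < r)
              Xh z ord0 a * Yv z ord0 b * dy b (A c a) z)
         - (\sum_(a < r) \sum_(n < r) \sum_(d < r)
              Xh z ord0 a * A n a z * Yh z ord0 d * dy n (A c d) z)
         - (\sum_(a < r) \sum_(d < r) \sum_(i < m)
              Xh z ord0 a * Yh z ord0 d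
              * rho_h L k (basept k z) a ord0 i * dx i (A c d) z)
         - (\sum_(a < r) \sum_(d < r) \sum_(n < r)
              Xh z ord0 a * Yh z ord0 d * H n a z * dy n (A c d) z)
         + (\sum_(a < r) \sum_(d < r) \sum_(b < r)
              Xh z ord0 a * Yh z ord0 d * A b d z * dy b (H c a) z)
         - (\sum_(a < r) \sum_(d < r)
              Xv z ord0 a * Yh z ord0 d * dy a (A c d) z))
        *: vert_base c z.
Proof.
move=> GambE dH dA dYh dYv X Y.
pose u := anchor L k (X z) z.
have dyGam b c a : dy b (Gam c a) z = - dy b (H c a) z by exact: (deriveN (dH c a b)).
have dyGamb b c a : dy b (Gamb c a) z = - dy b (H c a) z - dy b (A c a) z.
  rewrite -dyGam /dy (near_eq_derive _ (GambE c a)).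
  by rewrite (deriveB (derivableN (dH c a b))) //; exact: diff_derivable.
have dcoord (F : 'rV[R]_m * 'rV[R]_r -> 'rV[R]_r) a :
    differentiable F z -> differentiable (fun z' => F z' ord0 a) z.
  by move=> dF; exact: (differentiable_comp dF (differentiable_coord _ _ _)).
have vY a : vcomp Gamb Y a = fun z' => Yv z' ord0 a.
  apply/funext => z'; rewrite vcomp_adapted_sum big1 ?addr0 // => c _.
  by rewrite subrr mul0r.
have vYg a : vcomp Gamb Y a z = Yv z ord0 a by rewrite vY.
(* In [Gam - Gamb] the coefficients [H] cancel, so the derivative along [X] never falls on [H]. *)
have vYz a z' : (forall b a, Gamb b a z' = Gam b a z' - A b a z') ->
    vcomp Gam Y a z' = Yv z' ord0 a + \sum_(c < r) A a c z' * Yh z' ord0 c.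
  move=> e; rewrite vcomp_adapted_sum; congr (_ + _); apply: eq_bigr => c _.
  by rewrite e subKr.
have nGamb : \forall z' \near z, forall b a, Gamb b a z' = Gam b a z' - A b a z'.
  exact: (filter_forall _ (fun b => filter_forall _ (GambE b))).
have dvY a : 'D_u (vcomp Gam Y a) z = 'D_u (fun z' => Yv z' ord0 a) z
    + \sum_(c < r) (A a c z * 'D_u (fun z' => Yh z' ord0 c) z
                    + Yh z ord0 c * 'D_u (A a c) z).
  have dAY c : derivable (fun z' => A a c z' * Yh z' ord0 c) z u.
    by apply: diff_derivable; apply: differentiableM => //; exact: dcoord.
  rewrite (@near_eq_derive _ _ _ _
    ((fun z' => Yv z' ord0 a) + (fun z' => \sum_(c < r) A a c z' * Yh z' ord0 c))); last first.
    by near=> z'; apply: vYz; near: z'.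
  have [dsum dsumE] := derive_bigsum dAY.
  have dYva : derivable (fun z' => Yv z' ord0 a) z u.
    by apply: diff_derivable; exact: dcoord.
  rewrite (deriveD dYva dsum) dsumE; congr (_ + _).
  apply: eq_bigr => c _.
  have dYhc : derivable (fun z' => Yh z' ord0 c) z u.
    by apply: diff_derivable; exact: dcoord.
  have dAc : derivable (A a c) z u by exact: diff_derivable.
  by rewrite (deriveM dAc dYhc).
(* The natural vertical component of [X] is [Xv] minus the contraction of [Xh] with [Gamb], and
   [- Gamb = H + A] at [z]. *)
have dXA c d : 'D_u (A c d) z =
    \sum_(i < m) (\sum_(a < r) Xh z ord0 a * rho_h L k (basept k z) a ord0 i) * dx i (A c d) z
     + \sum_(n < r) (Xv z ord0 n + \sum_(a < r) Xh z ord0 a * (H n a z + A n a z)) * dy n (A c d) z.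
  rewrite derive_coords // /u /anchor /X adapted_sumE /=; congr (_ + _).
    apply: eq_bigr => i _; congr (_ * _).
    by rewrite summxE; apply: eq_bigr => a _; rewrite mxE.
  apply: eq_bigr => n _; congr (_ * _); rewrite mxE -sumrN; congr (_ + _).
  apply: eq_bigr => a _; rewrite (nbhs_singleton nGamb) /Gam; ring.
have XE a : (X z).1 ord0 a = Xh z ord0 a by rewrite /X adapted_sumE.
have YE a z' : (Y z').1 ord0 a = Yh z' ord0 a by rewrite /Y adapted_sumE.
rewrite /berwald -/u.
under [X in X + _ = _]eq_bigr => a _.
  rewrite (_ : (fun z' => (Y z').1 ord0 a) = (fun z' => Yh z' ord0 a)); last first.
    by apply/funext => z'.
  under [X in _ + X]eq_bigr do under eq_bigr do rewrite XE YE dyGamb.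
  over.
under [X in _ + X = _]eq_bigr => a _.
  rewrite vY; under [X in _ + X]eq_bigr do under eq_bigr do rewrite XE dyGamb vYg.
  over.
under [X in _ = X + _ - _ + _]eq_bigr => a _.
  rewrite (_ : (fun z' => (Y z').1 ord0 a) = (fun z' => Yh z' ord0 a)); last first.
    by apply/funext => z'.
  under [X in _ + X]eq_bigr do under eq_bigr do rewrite XE YE dyGam.
  over.
under [X in _ = _ + X - _ + _]eq_bigr => a _.
  rewrite dvY.
  under [X in _ + X]eq_bigr do under eq_bigr do
    rewrite XE dyGam (vYz _ _ (nbhs_singleton nGamb)).
  over.
rewrite [X in _ = X + _]addrAC -[RHS]addrA -sumrB -[X in _ = _ + X]big_split /=.
under [X in _ = X + _]eq_bigr do rewrite -scalerBl.
under [X in _ = _ + X]eq_bigr do rewrite -scalerDl.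
(* The two sides are written in different adapted bases; natural components make them comparable. *)
rewrite !base_sumE; congr pair.
  apply/rowP => c; rewrite !mxE -addrA; congr (_ + _); rewrite -sumrB.
  apply: eq_bigr => a _; rewrite -sumrB; apply: eq_bigr => b _; ring.
apply/rowP => c; rewrite !mxE.
have := @berwald_shift_vertical (Xh z ord0) (Xv z ord0) (Yh z ord0) (Yv z ord0)
  (fun a => 'D_u (fun z' => Yh z' ord0 a) z) (fun a => 'D_u (fun z' => Yv z' ord0 a) z)
  (fun b a => H b a z) (fun b a => A b a z)
  (fun b n a => dy b (H n a) z) (fun b n a => dy b (A n a) z)
  (fun a i => rho_h L k (basept k z) a ord0 i) (fun i n a => dx i (A n a) z)
  (fun n a => 'D_u (A n a) z) c (dXA c).
have -> : \sum_(a < r)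
     ('D_u (fun z' => Yh z' ord0 a) z +
      \sum_(c < r) \sum_(b < r) Xh z ord0 c * Yh z ord0 b * - dy b (H a c) z -
      \sum_(c < r) \sum_(b < r) Xh z ord0 c * Yh z ord0 b * dy b (A a c) z) *
     Gam c a z = \sum_(a < r)
     ('D_u (fun z' => Yh z' ord0 a) z +
      \sum_(c < r) \sum_(b < r)
        Xh z ord0 c * Yh z ord0 b * (- dy b (H a c) z - dy b (A a c) z)) * Gam c a z.
  apply: eq_bigr => a _; congr (_ * _); rewrite -addrA; congr (_ + _).
  rewrite -sumrB; apply: eq_bigr => e _; rewrite -sumrB; apply: eq_bigr => b _; ring.
(* Replacing [Gamb] by [Gam - A] splits off the sum with [Gam] common to both sides, leaving the
   auxiliary identity. *)
under [in X in _ -> _ - X = _]eq_bigr do rewrite (nbhs_singleton nGamb) mulrBr.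
by move=> e; rewrite sumrB opprB addrA; congr (_ - _).
Unshelve. all: by end_near. Qed.

End BerwaldShift.

(** * The horizontal component of the Berwald relation *)

Section BerwaldFst.
Context (R : realType) (m r : nat) (M : manifold R m) (E : vbundle M r)
  (h eta : diffeo M) (L : gen_lie_algebroid E h eta) (k : vbchart E).
Implicit Types (Gam A : 'I_r -> 'I_r -> 'rV[R]_m * 'rV[R]_r -> R)
  (z : 'rV[R]_m * 'rV[R]_r).

Lemma berwald_fst Gam X Y z b :
  (berwald L k Gam X Y z).1 ord0 b =
  'D_(anchor L k (X z) z) (fun z' => (Y z').1 ord0 b) z
  + \sum_(a < r) \sum_(c < r) (X z).1 ord0 a * (Y z).1 ord0 c * dy c (Gam b a) z.
Proof. by rewrite /berwald base_sumE /= mxE. Qed.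

(** Testing on the horizontal base sections [a] and [c] isolates one coefficient: the derivatives of
    the components of [Y] cancel. Only horizontal components are compared, so [V] is arbitrary. *)
Lemma berwald_shift_dy Gam Gamb A (V : 'I_r -> R) a b c z :
  let Xh : 'rV[R]_m * 'rV[R]_r -> 'rV[R]_r := cst (delta_mx ord0 a) in
  let Yh : 'rV[R]_m * 'rV[R]_r -> 'rV[R]_r := cst (delta_mx ord0 c) in
  let X := adapted_sum Gamb Xh (cst 0) in
  let Y := adapted_sum Gamb Yh (cst 0) in
  berwald L k Gamb X Y z =
    berwald L k Gam X Y z
    - \sum_(e < r) (\sum_(a' < r) \sum_(c' < r)
         Xh z ord0 a' * Yh z ord0 c' * dy c' (A e a') z) *: adapted_base Gam e z
    + \sum_(e < r) V e *: vert_base e z ->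
  dy c (Gamb b a) z = dy c (Gam b a) z - dy c (A b a) z.
Proof.
move=> Xh Yh X Y; rewrite sum_adapted_baseE sum_vert_baseE.
have fstE (u v s t : 'rV[R]_r * 'rV[R]_r) : u = v - s + t ->
    u.1 ord0 b = v.1 ord0 b - s.1 ord0 b + t.1 ord0 b by move=> ->; rewrite !mxE.
move=> /fstE; rewrite (berwald_fst Gamb) (berwald_fst Gam) [(0, _).1]/= [(\row_a _, _).1]/=.
rewrite !mxE addr0 -addrA => /addrI.
have delta (F : 'I_r -> 'I_r -> R) : \sum_(a' < r) \sum_(c' < r)
    Xh z ord0 a' * Yh z ord0 c' * F a' c' = F a c.
  under eq_bigr do under eq_bigr do rewrite !mxE eqxx /=.
  exact: sum_delta2.
have deltaXY (F : 'I_r -> 'I_r -> R) : \sum_(a' < r) \sum_(c' < r)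
    (X z).1 ord0 a' * (Y z).1 ord0 c' * F a' c' = F a c.
  by rewrite /X /Y !adapted_sumE delta.
by rewrite (deltaXY (fun a' c' => dy c' (Gamb b a') z))
  (deltaXY (fun a' c' => dy c' (Gam b a') z)) (delta (fun a' c' => dy c' (A b a') z)).
Qed.

End BerwaldFst.

(** * The horizontal projector of a spray *)

Section Chart.
Context (R : realType) (m r : nat) (M : manifold R m) (E : vbundle M r)
  (h eta : diffeo M) (L : gen_lie_algebroid E h eta) (G : loc_inv_morphism E h)
  (k : vbchart E).
Implicit Types (z : 'rV[R]_m * 'rV[R]_r) (S Sb : forall u : tspace E, gfib h u).

Lemma gdom_edom z : gdom h k z -> edom k z.
Proof. by move=> [p [kp _] pz]; exists p. Qed.

Lemma gdom_fibre z z' : z'.1 = z.1 -> gdom h k z -> gdom h k z'.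
Proof. by move=> e; rewrite /gdom /= e. Qed.

(** Openness lets identities that hold on [gdom] be differentiated there. *)
Lemma open_gdom : open (gdom h k).
Proof.
have [dom_open im_open cmapK _ cinv_cont] := atlas_chart (bchart_atlas k).
have [fr_open _] := frames_frame (bframe_frames k).
have [h_cont _] := dfun_smooth h.
have hdom_open : open (hdom h k).
  apply: openI; first exact: openI.
  by apply: open_comp => // x _; exact: h_cont.
(* [cinv] is controlled only on the image of the chart, hence the intersection. *)
have im_hdom : cmap (bchart k) @` hdom h k =
    cmap (bchart k) @` cdom (bchart k) `&` cinv (bchart k) @^-1` hdom h k.
  apply/seteqP; split=> [_ [p hp <-]|v [[p kp <-]]].
    have kp : cdom (bchart k) p by case: hp => -[].
    by split; [exists p | rewrite /= cmapK].
  by rewrite /= cmapK // => hp; exists p.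
rewrite (_ : gdom h k = fst @^-1` (cmap (bchart k) @` hdom h k)) //.
apply: open_comp; first by move=> z _; exact: cvg_fst.
rewrite im_hdom; rewrite openE => v [v_im v_h].
apply: filterI; first exact: open_nbhs_nbhs.
apply: (cinv_cont _ v_im); exact: open_nbhs_nbhs.
Qed.

Lemma near_gdom z : gdom h k z -> \forall z' \near z, gdom h k z'.
Proof. by move=> kz; apply: open_nbhs_nbhs; split; [exact: open_gdom|]. Qed.

(** The coefficients [gt_h] as functions of the base coordinates alone. *)
Definition gt_loc (a : 'I_r) (v : 'rV[R]_m) : 'rV[R]_r :=
  gt_h G k (cinv (bchart k) v) a.

Lemma gt_loc_differentiable a z : gdom h k z -> differentiable (gt_loc a) z.1.
Proof.
move=> kz.
have sm := gi_smooth G a (bframe_frames k) (bframe_frames k) (bchart_atlas k).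
apply: (smooth_on_differentiable sm).
by case: kz => p [[cp fp] hp] pz; exists p.
Qed.

Lemma gt_differentiable a z :
  gdom h k z -> differentiable (fun z' => gt_h G k (basept k z') a) z.
Proof.
move=> kz; apply: (@differentiable_comp _ _ _ _ fst (gt_loc a)).
  exact: differentiable_fst.
exact: gt_loc_differentiable.
Qed.

Lemma gsection_differentiable S z :
  gsection L S -> gdom h k z -> differentiable (gloc k S) z.
Proof. by move=> [_ /(_ k) sm]; exact: smooth_on_differentiable. Qed.

Lemma gsection_derive_differentiable S z v :
  gsection L S -> gdom h k z -> differentiable (fun z' => 'D_v (gloc k S) z') z.
Proof. by move=> [_ /(_ k) sm]; exact: smooth_on_derive_differentiable. Qed.

Lemma J_nat_base a :
  J G k (@nat_base R m r a) = fun z => (0, gt_h G k (basept k z) a).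
Proof.
apply/funext => z; rewrite /J /nat_base /=; congr pair.
rewrite (bigD1 a) //= mxE !eqxx scale1r big1 ?addr0 // => b ba.
by rewrite mxE eqxx (negbTE ba) scale0r.
Qed.

(* The part of the projector that only sees the first components of the spray, and
   so is shared by all sprays relative to the same (g,h). *)
Definition hproj_rest (a : 'I_r) z (p q : 'rV[R]_r) : 'rV[R]_r :=
  'D_(\sum_(e < r) p ord0 e *: rho_h L k (basept k z) e) (gt_loc a) z.1
  + \sum_(c < r) (q + \sum_(e < r) p ord0 e *: L_h L k (basept k z) a e) ord0 c
      *: gt_h G k (basept k z) c.

(** The bracket of [J (nat_base a)] with [S] contributes the derivative of S along the vertical
    vector [gt_h] minus a derivative of [gt_h]. Applying [J] to the other bracket keeps only its
    horizontal part. Everything but the first derivative goes into [hproj_rest]. *)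
Lemma HcoefE S b a z : gdom h k z ->
  Hcoef L G k S b a z =
  2%:R^-1 * (('D_(0, gt_h G k (basept k z) a) (gloc k S) z).2 ord0 b
    - hproj_rest a z (gloc k S z).1
        ('D_(rho_h L k (basept k z) a, 0) (gloc k S) z).1 ord0 b).
Proof.
move=> kz; rewrite /Hcoef /hproj.
have anchJ : anchor L k (J G k (@nat_base R m r a) z) z = (0, gt_h G k (basept k z) a).
  by rewrite J_nat_base /anchor /= big1 // => c _; rewrite mxE scale0r.
have anchN : anchor L k (@nat_base R m r a z) z = (rho_h L k (basept k z) a, 0).
  rewrite /anchor /nat_base /=; congr pair.
  rewrite (bigD1 a) //= mxE !eqxx scale1r big1 ?addr0 // => c ca.
  by rewrite mxE eqxx (negbTE ca) scale0r.
have dJ : differentiable (J G k (@nat_base R m r a)) z.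
  rewrite J_nat_base; apply: differentiable_pair; first exact: differentiable_cst.
  exact: gt_differentiable.
have lbrJ : (lbr L k (J G k (@nat_base R m r a)) (gloc k S) z).2 =
    ('D_(0, gt_h G k (basept k z) a) (gloc k S) z).2
    - 'D_(\sum_(e < r) (gloc k S z).1 ord0 e *: rho_h L k (basept k z) e) (gt_loc a) z.1.
  rewrite /lbr anchJ /= addr0; congr (_ - _).
  by rewrite -derive_snd // J_nat_base.
have lbrN : (lbr L k (@nat_base R m r a) (gloc k S) z).1 =
    ('D_(rho_h L k (basept k z) a, 0) (gloc k S) z).1
    + \sum_(e < r) (gloc k S z).1 ord0 e *: L_h L k (basept k z) a e.
  rewrite /lbr anchN.
  have -> : 'D_(anchor L k (gloc k S z) z) (@nat_base R m r a) z = 0 by exact: derive_cst.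
  rewrite subr0 /=; congr (_ + _).
  rewrite (bigD1 a) //= [X in _ + X]big1 ?addr0 => [|d da]; last first.
    by rewrite big1 // => e _; rewrite mxE eqxx (negbTE da) mul0r scale0r.
  by apply: eq_bigr => e _; rewrite mxE !eqxx mul1r.
(* The leading 0 is the vertical part of [nat_base a]. *)
transitivity ((2%:R^-1 *: ((0 : 'rV[R]_r)
    + (lbr L k (J G k (@nat_base R m r a)) (gloc k S) z).2
    - \sum_(c < r) (lbr L k (@nat_base R m r a) (gloc k S) z).1 ord0 c
                    *: gt_h G k (basept k z) c)) ord0 b); first by [].
by rewrite lbrJ lbrN add0r /hproj_rest -addrA -opprD !mxE.
Qed.

End Chart.

(** * The vertical difference of two sprays and its effect on the projector *)

Section SprayChart.
Context (R : realType) (m r : nat) (M : manifold R m) (E : vbundle M r)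
  (h eta : diffeo M) (L : gen_lie_algebroid E h eta) (G : loc_inv_morphism E h)
  (k : vbchart E).
Implicit Types (z : 'rV[R]_m * 'rV[R]_r) (S Sb : forall u : tspace E, gfib h u).

Definition vdiff S Sb (b : 'I_r) z : R :=
  (gloc k Sb z).2 ord0 b - (gloc k S z).2 ord0 b.

Lemma differentiable_vcoord S b z : gsection L S -> gdom h k z ->
  differentiable (fun z' => (gloc k S z').2 ord0 b) z.
Proof.
move=> sS kz; apply: differentiable_row_coord; apply: differentiable_pair2.
exact: (gsection_differentiable sS kz).
Qed.

Lemma derive_vcoord S b z v : gsection L S -> gdom h k z ->
  'D_v (fun z' => (gloc k S z').2 ord0 b) z = ('D_v (gloc k S) z).2 ord0 b.
Proof.
move=> sS kz; have dS := gsection_differentiable sS kz.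
by rewrite derive_row_coord ?derive_snd //; exact: differentiable_pair2.
Qed.

Lemma differentiable_vdiff S Sb b z : gsection L S -> gsection L Sb -> gdom h k z ->
  differentiable (vdiff S Sb b) z.
Proof. by move=> sS sSb kz; apply: differentiableB; exact: differentiable_vcoord. Qed.

Lemma derive_vdiff S Sb b z v : gsection L S -> gsection L Sb -> gdom h k z ->
  'D_v (vdiff S Sb b) z = ('D_v (gloc k Sb) z).2 ord0 b - ('D_v (gloc k S) z).2 ord0 b.
Proof.
move=> sS sSb kz.
apply: etrans (congr2 (fun x y => x - y)
  (derive_vcoord b v sSb kz) (derive_vcoord b v sS kz)).
exact: (deriveB (diff_derivable (v := v) (differentiable_vcoord b sSb kz))
  (diff_derivable (v := v) (differentiable_vcoord b sS kz))).
Qed.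

Lemma derive_vdiff_differentiable S Sb b z v :
  gsection L S -> gsection L Sb -> gdom h k z ->
  differentiable (fun z' => 'D_v (vdiff S Sb b) z') z.
Proof.
move=> sS sSb kz.
apply: (@near_eq_differentiable _ _ _ (fun z' =>
  ('D_v (gloc k Sb) z').2 ord0 b - ('D_v (gloc k S) z').2 ord0 b)).
  by apply: filterS (near_gdom kz) => z' kz'; rewrite derive_vdiff.
have dD S' : gsection L S' ->
    differentiable (fun z' => ('D_v (gloc k S') z').2 ord0 b) z.
  move=> sS'; have dDS := gsection_derive_differentiable v sS' kz.
  exact: (differentiable_row_coord b (differentiable_pair2 dDS)).
exact: (differentiableB (dD _ sSb) (dD _ sS)).
Qed.

(** [hproj_rest] sees a spray through its first components and their derivatives at [z]; these agree
    because the first components agree on an open set. *)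
Lemma Hcoef_diff S Sb b a z : gsection L S -> gsection L Sb ->
  (forall z', gdom h k z' -> (gloc k Sb z').1 = (gloc k S z').1) -> gdom h k z ->
  Hcoef L G k Sb b a z =
  Hcoef L G k S b a z
  + 2%:R^-1 * 'D_(0, gt_h G k (basept k z) a) (vdiff S Sb b) z.
Proof.
move=> sS sSb S1 kz.
rewrite (HcoefE L G Sb b a kz) (HcoefE L G S b a kz) (derive_vdiff b _ sS sSb kz).
have restE : hproj_rest L G k a z (gloc k Sb z).1
      ('D_(rho_h L k (basept k z) a, 0) (gloc k Sb) z).1 =
    hproj_rest L G k a z (gloc k S z).1
      ('D_(rho_h L k (basept k z) a, 0) (gloc k S) z).1.
  apply: congr2; first exact: S1.
  apply: etrans (derive_fst _ (gsection_differentiable sS kz)).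
  apply: etrans (esym (derive_fst _ (gsection_differentiable sSb kz))) _.
  by apply: near_eq_derive; apply: filterS (near_gdom kz).
have alg (c x x' y : R) : c * (x - y) = c * (x' - y) + c * (x - x') by ring.
apply: etrans (congr1 (fun w : 'rV[R]_r => 2%:R^-1 * (_ - w ord0 b)) restE) _.
exact: alg.
Qed.

(** Along a fibre [gt_h], [rho_h] and [L_h] are constant. Freezing them at the base point of [z]
    gives the function [F], differentiable because S is smooth and equal to [Hcoef] on that
    fibre. *)
Lemma Hcoef_derivable S b a z (v : 'rV[R]_r) : gsection L S -> gdom h k z ->
  derivable (Hcoef L G k S b a) z (0, v).
Proof.
move=> sS kz; pose x := basept k z.
pose F z' : R := 2%:R^-1 * (('D_(0, gt_h G k x a) (gloc k S) z').2 ord0 b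
    - (\sum_(e < r) (gloc k S z').1 ord0 e * 'D_(rho_h L k x e) (gt_loc G k a) z.1 ord0 b
       + \sum_(c < r) (('D_(rho_h L k x a, 0) (gloc k S) z').1 ord0 c
           + \sum_(e < r) (gloc k S z').1 ord0 e * L_h L k x a e ord0 c)
           * gt_h G k x c ord0 b)).
have dF : differentiable F z.
  have dS := gsection_differentiable sS kz.
  have dS1 e : differentiable (fun z' => (gloc k S z').1 ord0 e) z.
    exact: (differentiable_row_coord e (differentiable_pair1 dS)).
  have dDS w := gsection_derive_differentiable w sS kz.
  have dcst (c : R) : differentiable (cst c : 'rV[R]_m * 'rV[R]_r -> R) z.
    exact: differentiable_cst.
  have d1 := differentiable_row_coord b (differentiable_pair2 (dDS (0, gt_h G k x a))).
  have d2 e := differentiableM (dS1 e)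
    (dcst ('D_(rho_h L k x e) (gt_loc G k a) z.1 ord0 b)).
  have d3 c := differentiable_row_coord c (differentiable_pair1 (dDS (rho_h L k x a, 0))).
  have d4 c e := differentiableM (dS1 e) (dcst (L_h L k x a e ord0 c)).
  have d5 c := differentiableM (differentiableD (d3 c) (differentiable_bigsum (d4 c)))
    (dcst (gt_h G k x c ord0 b)).
  exact: (differentiableM (dcst 2%:R^-1) (differentiableB d1
    (differentiableD (differentiable_bigsum d2) (differentiable_bigsum d5)))).
apply: (derivable_line _ (diff_derivable (v := (0, v)) dF)) => t.
set z' := t *: _ + z.
have z'1 : z'.1 = z.1 by rewrite /z' /= scaler0 add0r.
have kz' : gdom h k z' := gdom_fibre z'1 kz.
have xE : basept k z' = x by rewrite /basept z'1.
rewrite (HcoefE L G S b a kz') /F /hproj_rest xE z'1 mxE.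
congr (_ * (_ - (_ + _))).
  (* Linearity of the differential of [gt_loc] moves the varying components of S out of the
     direction. *)
  have dgt := gt_loc_differentiable G a kz.
  rewrite deriveE // linear_sum summxE /=; apply: eq_bigr => e _.
  by rewrite linearZ deriveE // mxE.
rewrite summxE; apply: eq_bigr => c _; rewrite mxE; congr (_ * _); rewrite mxE; congr (_ + _).
by rewrite summxE; apply: eq_bigr => e _; rewrite mxE.
Qed.

(** Product rule for [f y^b]; the direction is vertical, so only the fibre derivatives of f
    appear. *)
Lemma AcoefE (f : tspace E -> R) b a z : differentiable (floc k f) z ->
  Acoef G k f b a z =
  2%:R^-1 * 'D_(0, gt_h G k (basept k z) a) (fun z' => floc k f z' * z'.2 ord0 b) z.
Proof.
move=> df; set g := gt_h _ _ _ _.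
have dy2 : differentiable (fun z' : 'rV[R]_m * 'rV[R]_r => z'.2 ord0 b) z.
  by apply: differentiable_row_coord; exact: differentiable_snd.
rewrite deriveM; [|exact: diff_derivable..].
have -> : 'D_(0, g) (fun z' : 'rV[R]_m * 'rV[R]_r => z'.2 ord0 b) z = g ord0 b.
  rewrite derive_row_coord; last exact: differentiable_snd.
  by rewrite (derive_snd (F := id)) // derive_id.
rewrite derive_coords //= big1 => [|i _]; last by rewrite mxE mul0r.
rewrite add0r /Acoef -/g mulrDr addrC /GRing.scale /= mulrA; congr (_ + _ * _).
by rewrite mulr_sumr; apply: eq_bigr => c _; ring.
Qed.

(** The direction varies with the point, so the derivative is first expanded into products of
    differentiable functions. *)
Lemma derive_vdiff_fibre_differentiable S Sb b a z :
  gsection L S -> gsection L Sb -> gdom h k z ->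
  differentiable
    (fun z' => 'D_(0, gt_h G k (basept k z') a) (vdiff S Sb b) z') z.
Proof.
move=> sS sSb kz.
apply: (@near_eq_differentiable _ _ _ (fun z' =>
  \sum_(c < r) gt_h G k (basept k z') a ord0 c * dy c (vdiff S Sb b) z')).
  apply: filterS (near_gdom kz) => z' kz'.
  rewrite derive_coords; last exact: differentiable_vdiff.
  by rewrite /= [X in _ = X + _]big1 ?add0r // => i _; rewrite mxE mul0r.
apply: differentiable_bigsum => c; apply: differentiableM.
  by apply: differentiable_row_coord; exact: gt_differentiable.
exact: derive_vdiff_differentiable.
Qed.

(** The vertical part of [C,S] - S = 0 reads D_y S - S - S = 0: one S comes from differentiating the
    Liouville section, and the [L_h] term is horizontal. *)
Lemma spray_euler sys S z b : spray G (A := L) sys S -> gdom h k z ->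
  'D_(0, z.2) (fun z' => (gloc k S z').2 ord0 b) z = 2%:R * (gloc k S z).2 ord0 b.
Proof.
move=> [[sS _] _ CS] kz.
have dS := gsection_differentiable sS kz.
have anchC : anchor L k (@liouville R m r z) z = (0, z.2).
  by rewrite /anchor /liouville /= big1 // => a _; rewrite mxE scale0r.
have dC w : ('D_w (@liouville R m r) z).2 = w.2.
  have dl : differentiable (@liouville R m r) z.
    by apply: differentiable_pair; [exact: differentiable_cst|exact: differentiable_snd].
  apply: etrans (esym (derive_snd w dl)) _.
  have did : differentiable (id : 'rV[R]_m * 'rV[R]_r -> _) z by [].
  by apply: etrans (derive_snd w did) _; rewrite derive_id.
have lbrC : (lbr L k (@liouville R m r) (gloc k S) z - gloc k S z).2 ord0 b =
    ('D_(0, z.2) (gloc k S) z).2 ord0 b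
    - ('D_(anchor L k (gloc k S z) z) (@liouville R m r) z).2 ord0 b
    - (gloc k S z).2 ord0 b.
  by rewrite /lbr anchC /= !mxE addr0.
have := congr1 (fun w : 'rV[R]_r * 'rV[R]_r => w.2 ord0 b) (CS k z kz).
move=> /(etrans (esym lbrC)).
have alg (D l p : R) : p = l -> D - p - l = 0 -> D = 2%:R * l.
  by move=> -> /eqP; rewrite -addrA -opprD subr_eq0 => /eqP ->; rewrite mulr_natl mulr2n.
have pl : ('D_(anchor L k (gloc k S z) z) (@liouville R m r) z).2 ord0 b =
    (gloc k S z).2 ord0 b by rewrite dC.
move=> e; have {}e : _ = 0 := etrans e (mxE _ _ _ _).
exact: etrans (derive_vcoord b _ sS kz) (alg _ _ _ pl e).
Qed.

Lemma spray_gt sys S z : spray G (A := L) sys S -> gdom h k z ->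
  \sum_(a < r) (gloc k S z).1 ord0 a *: gt_h G k (basept k z) a = z.2.
Proof.
by move=> [[_ /(_ k)[JS _]] _ _] kz; have := congr1 snd (JS z kz).
Qed.

(** The local form of a semispray fixes its first component in terms of [G] and the point alone. *)
Lemma spray_fst sys sysb S Sb z :
  spray G (A := L) sys S -> spray G (A := L) sysb Sb -> gdom h k z ->
  (gloc k Sb z).1 = (gloc k S z).1.
Proof.
move=> [[_ /(_ k)[_ [Gc [_ SE]]]] _ _] [[_ /(_ k)[_ [Gcb [_ SbE]]]] _ _] kz.
have S1 : (gloc k S z).1 = \sum_(b < r) z.2 ord0 b *: g_h G k (basept k z) b.
  by rewrite (SE z kz).
have Sb1 : (gloc k Sb z).1 = \sum_(b < r) z.2 ord0 b *: g_h G k (basept k z) b.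
  by rewrite (SbE z kz).
exact: etrans Sb1 (esym S1).
Qed.

End SprayChart.

(** * Comparison of the projectors with the coefficients A of a function f *)

Section Sprays.
Context (R : realType) (m r : nat) (M : manifold R m) (E : vbundle M r)
  (h eta : diffeo M) (L : gen_lie_algebroid E h eta) (G : loc_inv_morphism E h)
  (sys sysb : mech_system L) (S Sb : forall u : tspace E, gfib h u)
  (hS : spray G sys S) (hSb : spray G sysb Sb) (f : tspace E -> R)
  (f1 : homogeneous1 f) (fC1 : C1_fun f) (k : vbchart E).
Implicit Types z : 'rV[R]_m * 'rV[R]_r.

Let sS : gsection L S. Proof. by case: hS => -[? _] _ _. Qed.
Let sSb : gsection L Sb. Proof. by case: hSb => -[? _] _ _. Qed.

Lemma floc_differentiable z : gdom h k z -> differentiable (floc k f) z.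
Proof. by move=> kz; have [df _] := fC1 k; exact: (df _ (gdom_edom kz)). Qed.

Lemma floc_euler z : gdom h k z -> 'D_(0, z.2) (floc k f) z = floc k f z.
Proof.
move=> kz; rewrite derive_coords; last exact: floc_differentiable.
by rewrite /= big1 ?add0r => [|i _]; [exact: (f1 (gdom_edom kz)) | rewrite mxE mul0r].
Qed.

Lemma Hcoef_vdiff b a z : gdom h k z ->
  Hcoef L G k Sb b a z = Hcoef L G k S b a z
    + 2%:R^-1 * 'D_(0, gt_h G k (basept k z) a) (vdiff k S Sb b) z.
Proof.
move=> kz; apply: (Hcoef_diff G b a sS sSb _ kz) => z' kz'.
exact: (spray_fst hS hSb kz').
Qed.

Lemma proj_Hcoef b a z :
  (forall z', gdom h k z' -> forall c, vdiff k S Sb c z' = floc k f z' * z'.2 ord0 c) ->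
  gdom h k z -> Hcoef L G k Sb b a z = Hcoef L G k S b a z + Acoef G k f b a z.
Proof.
move=> SfC kz; apply: etrans (Hcoef_vdiff b a kz) _; congr (_ + _).
apply: etrans (esym (AcoefE G b a (floc_differentiable kz))); congr (_ * _).
by apply: near_eq_derive; apply: filterS (near_gdom kz) => z' kz'; exact: SfC.
Qed.

(** On the fibre over [x], the hypothesis at the origin feeds [homogeneous2_rigidity] for each
    [gt_h]. Since the vectors [gt_h] combine to [y], the derivatives along [y] agree, and Euler's
    identity removes them. *)
Lemma vdiff_floc b z :
  (forall a b c z', gdom h k z' -> dy c (Hcoef L G k Sb b a) z' =
     dy c (Hcoef L G k S b a) z' + dy c (Acoef G k f b a) z') ->
  gdom h k z -> vdiff k S Sb b z = floc k f z * z.2 ord0 b.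
Proof.
move=> dyH; case: z => x y kz.
have kx y' : gdom h k (x, y') by exact: (gdom_fibre (z := (x, y))).
pose w y' := vdiff k S Sb b (x, y').
pose phi y' := floc k f (x, y').
pose p y' := phi y' * y' ord0 b.
have dw y' : differentiable w y'.
  exact: differentiable_fibre (differentiable_vdiff b sS sSb (kx y')).
have ew y' : 'D_y' w y' = 2%:R * w y'.
  apply: etrans (derive_fibre _ _ _ _) _.
  have eS := spray_euler b hS (kx y'); have eSb := spray_euler b hSb (kx y').
  apply: etrans (deriveB
    (diff_derivable (v := (0, y')) (differentiable_vcoord b sSb (kx y')))
    (diff_derivable (v := (0, y')) (differentiable_vcoord b sS (kx y')))) _.
  apply: etrans (congr2 (fun s t => s - t) eSb eS) _.
  exact: esym (mulrBr _ _ _).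
have dphi y' : differentiable phi y'.
  exact: differentiable_fibre (floc_differentiable (kx y')).
have ephi y' : 'D_y' phi y' = phi y'.
  exact: etrans (derive_fibre _ _ _ _) (floc_euler (kx y')).
have dcoord y' : differentiable (fun y' : 'rV[R]_r => y' ord0 b) y'.
  exact: differentiable_coord.
have DwE a y' : 'D_(gt_h G k (basept k (x, y)) a) w y' =
    'D_(gt_h G k (basept k (x, y)) a) p y'.
  apply: (homogeneous2_rigidity dw ew _ dphi ephi).
    (* [basept] is constant on the fibre, so the direction may be written as depending on the
       point. *)
    rewrite (_ : (fun y' => _) = (fun y' =>
      'D_(0, gt_h G k (basept k (x, y')) a) (vdiff k S Sb b) (x, y'))); last first.
      by apply/funext => u; exact: derive_fibre.
    exact: differentiable_fibre (derive_vdiff_fibre_differentiable G b a sS sSb (kx 0)).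
  move=> c.
  pose B z' := 2%:R^-1 * 'D_(0, gt_h G k (basept k z') a) (vdiff k S Sb b) z'.
  have -> : (fun y' => 2%:R^-1 * 'D_(gt_h G k (basept k (x, y)) a) w y') =
      (fun y' => B (x, y')).
    apply/funext => u.
    exact: (congr1 (fun t : R => 2%:R^-1 * t) (derive_fibre (vdiff k S Sb b) x u _)).
  have -> : (fun y' => 2%:R^-1 * 'D_(gt_h G k (basept k (x, y)) a) p y') =
      (fun y' => Acoef G k f b a (x, y')).
    apply/funext => u; apply: etrans (esym (AcoefE G b a (floc_differentiable (kx u)))).
    exact: (congr1 (fun t : R => 2%:R^-1 * t)
      (derive_fibre (fun z' => floc k f z' * z'.2 ord0 b) x u _)).
  apply: etrans (derive_fibre _ _ _ _) _.
  apply: etrans (esym (derive_fibre _ _ _ _)).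
  (* Adding the derivative of the coefficient of S turns both sides into that of [Sb], where [dyH]
     applies. *)
  apply: (@addrI _ (dy c (Hcoef L G k S b a) (x, 0))).
  apply: etrans (dyH a b c _ (kx 0)).
  have dB : derivable B (x, 0) (0, delta_mx ord0 c).
    apply: derivableZ; apply: diff_derivable.
    exact: (derive_vdiff_fibre_differentiable G b a sS sSb (kx 0)).
  have dH : derivable (Hcoef L G k S b a) (x, 0) (0, delta_mx ord0 c).
    exact: Hcoef_derivable sS (kx 0).
  have DD : 'D_(0, delta_mx ord0 c) (Hcoef L G k S b a + B) (x, 0) =
      dy c (Hcoef L G k S b a) (x, 0) + 'D_(0, delta_mx ord0 c) B (x, 0).
    exact: deriveD dH dB.
  apply: etrans (esym DD) _.
  apply: near_eq_derive; apply: filterS (near_gdom (kx 0)) => z' kz'.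
  exact: esym (Hcoef_vdiff b a kz').
have dp : differentiable p y by exact: (differentiableM (dphi y) (dcoord y)).
have : 'D_y w y = 'D_y p y.
  have yE : y = \sum_(a < r) (gloc k S (x, y)).1 ord0 a *: gt_h G k (basept k (x, y)) a.
    exact: esym (spray_gt hS kz).
  have lin (F : {linear 'rV[R]_r -> R}) : F y =
      \sum_(a < r) (gloc k S (x, y)).1 ord0 a * F (gt_h G k (basept k (x, y)) a).
    by rewrite {1}yE linear_sum; apply: eq_bigr => a _; rewrite linearZ.
  apply: etrans (deriveE y (dw y)) _; apply: etrans _ (esym (deriveE y dp)).
  apply: etrans (lin _) _; apply: etrans _ (esym (lin _)).
  apply: eq_bigr => a _; apply: (congr1 (fun t : R => _ * t)).
  exact: etrans (esym (deriveE _ (dw y))) (etrans (DwE a y) (deriveE _ dp)).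
(* Both [w] and [p] have degree 2, so the equality of derivatives reads 2w = 2p. *)
rewrite ew (deriveM (diff_derivable (v := y) (dphi y)) (diff_derivable (v := y) (dcoord y))).
rewrite ephi (derive_row_coord (F := id)) // derive_id /GRing.scale /=.
rewrite /w /phi /=; move: (vdiff _ _ _ _ _) (floc _ _ _) => s t; lra.
Qed.

End Sprays.

(** * Reduction to vertical components, regularity of A, and the equivalence *)

Section Main.
Context (R : realType) (m r : nat) (M : manifold R m) (E : vbundle M r)
  (h eta : diffeo M) (L : gen_lie_algebroid E h eta) (G : loc_inv_morphism E h)
  (sys sysb : mech_system L) (S Sb : forall u : tspace E, gfib h u)
  (hS : spray G sys S) (hSb : spray G sysb Sb) (f : tspace E -> R)
  (f1 : homogeneous1 f) (fC1 : C1_fun f) (k : vbchart E).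

Lemma gloc_vdiffP z : gdom h k z ->
  gloc k Sb z = gloc k S z + floc k f z *: (@liouville R m r z) <->
  forall c, vdiff k S Sb c z = floc k f z * z.2 ord0 c.
Proof.
move=> kz; have S1 := spray_fst hS hSb kz; rewrite /vdiff /liouville.
move: (gloc k Sb z) (gloc k S z) (floc k f z) S1 => [s1 s2] [t1 t2] x /= ->.
split=> [[_ ->] c|e]; first by rewrite !mxE; ring.
congr pair; rewrite /= ?scaler0 ?addr0 //.
by apply/rowP => c; rewrite !mxE -e; ring.
Qed.

(** A contains derivatives of f, which is only of class C^1. The projective relation identifies A
    near [z] with half the derivative of the difference of two smooth sections, which is
    differentiable. *)
Lemma Acoef_differentiable b a z :
  (forall z', gdom h k z' ->
     gloc k Sb z' = gloc k S z' + floc k f z' *: (@liouville R m r z')) ->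
  gdom h k z -> differentiable (Acoef G k f b a) z.
Proof.
move=> SfC kz.
have sS : gsection L S by case: hS => -[? _] _ _.
have sSb : gsection L Sb by case: hSb => -[? _] _ _.
have dB := derive_vdiff_fibre_differentiable G b a sS sSb kz.
have dcst : differentiable (cst 2%:R^-1 : 'rV[R]_m * 'rV[R]_r -> R) z.
  exact: differentiable_cst.
apply: near_eq_differentiable (differentiableM dcst dB).
apply: filterS (near_gdom kz) => z' kz'.
(* Added to the coefficient of S, either expression gives that of [Sb]. *)
apply: (@addrI _ (Hcoef L G k S b a z')).
apply: etrans (esym (Hcoef_vdiff hS hSb b a kz')) _.
exact: (proj_Hcoef hS hSb fC1 b a (fun y ky => (gloc_vdiffP ky).1 (SfC y ky)) kz').
Qed.

End Main.

Unset Implicit Arguments.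
Set Strict Implicit.

Theorem theorem5p15 (R : realType) (m r : nat) (M : manifold R m)
    (E : vbundle M r) (h eta : diffeo M) (L : gen_lie_algebroid E h eta)
    (G : loc_inv_morphism E h)
    (sys sysb : mech_system L)
    (S Sb : forall u : tspace E, gfib h u)
    (hS : spray G sys S) (hSb : spray G sysb Sb) :
  proj_related S Sb
  <->
  exists f : tspace E -> R,
    [/\ homogeneous1 f, C1_fun f &
    forall (k : vbchart E) (Xh Xv Yh Yv : 'rV[R]_m * 'rV[R]_r -> 'rV[R]_r),
      smooth_on (gdom h k) Xh -> smooth_on (gdom h k) Xv ->
      smooth_on (gdom h k) Yh -> smooth_on (gdom h k) Yv ->
      let Gam := spray_conn L G k S in
      let Gamb := spray_conn L G k Sb in
      let H := Hcoef L G k S in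
      let A := Acoef G k f in
      let X := adapted_sum Gamb Xh Xv in
      let Y := adapted_sum Gamb Yh Yv in
      forall z, gdom h k z ->
        berwald L k Gamb X Y z =
          berwald L k Gam X Y z
          - \sum_(c < r) (\sum_(a < r) \sum_(b < r)
               Xh z ord0 a * Yh z ord0 b * dy b (A c a) z)
              *: adapted_base Gam c z
          + \sum_(c < r)
              (- (\sum_(a < r) \sum_(b < r) \sum_(n < r)
                    Xh z ord0 a * Yh z ord0 b * A c n z * dy b (H n a) z)
               - (\sum_(a < r) \sum_(b < r) \sum_(n < r)
                    Xh z ord0 a * Yh z ord0 b * A c n z * dy b (A n a) z)
               - (\sum_(a < r) \sum_(b < r)
                    Xh z ord0 a * Yv z ord0 b * dy b (A c a) z)
               - (\sum_(a < r) \sum_(n < r) \sum_(d < r)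
                    Xh z ord0 a * A n a z * Yh z ord0 d * dy n (A c d) z)
               - (\sum_(a < r) \sum_(d < r) \sum_(i < m)
                    Xh z ord0 a * Yh z ord0 d
                    * rho_h L k (basept k z) a ord0 i * dx i (A c d) z)
               - (\sum_(a < r) \sum_(d < r) \sum_(n < r)
                    Xh z ord0 a * Yh z ord0 d * H n a z * dy n (A c d) z)
               + (\sum_(a < r) \sum_(d < r) \sum_(b < r)
                    Xh z ord0 a * Yh z ord0 d * A b d z * dy b (H c a) z)
               - (\sum_(a < r) \sum_(d < r)
                    Xv z ord0 a * Yh z ord0 d * dy a (A c d) z))
              *: vert_base c z].
Proof.
have sS : gsection L S by case: hS => -[? _] _ _.
(* The same [f] serves as witness in both directions. *)
split=> [[f [f1 fC1 SfC]]|[f [f1 fC1 rel]]]; exists f; split=> //.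
- move=> k Xh Xv Yh Yv _ _ sYh sYv Gam Gamb H A X Y z kz.
  have H_A b a z' : gdom h k z' -> Gamb b a z' = - H b a z' - A b a z'.
    move=> kz'; apply: etrans (opprD _ _); congr (- _).
    exact: (proj_Hcoef hS hSb fC1 b a
      (fun y ky => (gloc_vdiffP hS hSb f ky).1 (SfC k y ky)) kz').
  apply: (@berwald_shift _ _ _ _ _ _ _ L k H A Gamb Xh Xv Yh Yv z).
  + by move=> b a; apply: filterS (near_gdom kz) => z'; exact: H_A.
  + by move=> b a c; exact: Hcoef_derivable sS kz.
  + by move=> b a; exact: (Acoef_differentiable hS hSb fC1 b a (SfC k) kz).
  + exact: smooth_on_differentiable sYh kz.
  + exact: smooth_on_differentiable sYv kz.
- move=> k z kz; apply/(gloc_vdiffP hS hSb f kz) => c.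
  apply: (vdiff_floc hS hSb f1 fC1) kz => a b e z' kz'.
  have smc (w : 'rV[R]_r) : smooth_on (gdom h k) (cst w : 'rV[R]_m * 'rV[R]_r -> 'rV[R]_r).
    exact: smooth_on_cst.
  (* Constant components select the horizontal base sections with indices [a] and [e]. *)
  have shift := @berwald_shift_dy _ _ _ _ _ _ _ L k (spray_conn L G k S)
    (spray_conn L G k Sb) (Acoef G k f) _ a b e z' (rel k (cst (delta_mx ord0 a)) (cst 0)
    (cst (delta_mx ord0 e)) (cst 0) (smc _) (smc _) (smc _) (smc _) z' kz').
  have dN (S' : forall u : tspace E, gfib h u) : gsection L S' ->
      dy e (spray_conn L G k S' b a) z' = - dy e (Hcoef L G k S' b a) z'.
    move=> sS'; have dH : derivable (Hcoef L G k S' b a) z' (0, delta_mx ord0 e).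
      exact: Hcoef_derivable sS' kz'.
    exact: deriveN dH.
  have sSb : gsection L Sb by case: hSb => -[? _] _ _.
  (* The connection coefficients are [- Hcoef], so both signs are reversed to reach the form
     expected by [vdiff_floc]. *)
  have sub_dN := congr1 (fun t => t - dy e (Acoef G k f b a) z') (dN _ sS).
  have neg_dH := etrans (etrans (esym (dN _ sSb)) shift) sub_dN.
  exact: oppr_inj (etrans neg_dH (esym (opprD _ _))).
Qed.
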